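(* Let $S$ be a simplicial set and let $a,b\in S_0$. Then the mapping space $\mathfrak{C}(S)(a,b)$ is the simplicial set described as follows. An $n$-simplex is an equivalence class of triples $[T,T\to S,\vec{T}]$, where $T$ is a necklace, $T\to S$ is a map of simplicial sets sending $\alpha_T$ to $a$ and $\omega_T$ to $b$, and $\vec{T}$ is a flag $T^0\subseteq T^1\subseteq\cdots\subseteq T^n$ of sets of vertices of $T$ such that $T^0$ contains all joints of $T$. The equivalence relation is generated by declaring $[T,T\to S,\vec{T}]$ and $[U,U\to S,\vec{U}]$ equivalent whenever there is a map of necklaces $f\colon T\to U$ over $S$ with $\vec{U}=f_*(\vec{T})$, i.e. $U^i=f(T^i)$ for all $i$. The $i$th face map omits $T^i$ from the flag, and the $i$th degeneracy map repeats $T^i$. Moreover, for $a,b,c\in S_0$, under this description the composition pairing $$\mathfrak{C}(S)(b,c)\times\mathfrak{C}(S)(a,b)\longrightarrow\mathfrak{C}(S)(a,c)$$ sends a pair of $n$-simplices $([T,T\to S,\vec{T}],[U,U\to S,\vec{U}])$ to the $n$-simplex $[U\vee T,U\vee T\to S,\overrightarrow{U^i\cup T^i}]$, whose flag has $i$th term $U^i\cup T^i$.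
   Context: The functor $\mathfrak{C}\colon s\mathrm{Set}\to s\mathrm{Cat}$ (where $s\mathrm{Cat}$ is the category of simplicially enriched categories): it is the left adjoint of the coherent nerve. Explicitly, $\mathfrak{C}(\Delta^n)$ has object set $\{0,\dots,n\}$, and $\mathfrak{C}(\Delta^n)(i,j)$ is the nerve of the poset $P_{i,j}$ of all subsets of $\{i,i+1,\dots,j\}$ containing $i$ and $j$, ordered by inclusion (empty if $j<i$), with composition given by union of sets; monotone maps $[m]\to[n]$ act by taking images. For a simplicial set $S$, $\mathfrak{C}(S)=\operatorname{colim}_{\Delta^n\to S}\mathfrak{C}(\Delta^n)$, the colimit being taken in $s\mathrm{Cat}$; its object set is $S_0$. A necklace is a simplicial set $\Delta^{n_0}\vee\cdots\vee\Delta^{n_k}$, $n_i\ge0$, where the final vertex of $\Delta^{n_i}$ is glued to the initial vertex of $\Delta^{n_{i+1}}$; it is in preferred form if $k=0$ or every $n_i\ge1$, and then the $\Delta^{n_i}$ are its beads. A joint is an initial or final vertex of some bead. $\alpha_T,\omega_T$ denote the first and last vertices of $T$. $U\vee T$ is the necklace obtained by gluing $\omega_U$ to $\alpha_T$; vertices of $U$ and $T$ are regarded as vertices of $U\vee T$. Maps of necklaces are maps of simplicial sets preserving first and last vertices; a map over $S$ is one commuting with the given maps to $S$. *)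

(* Defs.v *)
From mathcomp Require Import all_boot.
From mathcomp Require Import boolp classical_sets.
From Stdlib Require Import Relation_Operators.

Set Implicit Arguments.
Unset Strict Implicit.
Unset Printing Implicit Defensive.

Local Open Scope classical_set_scope.
Local Open Scope quotient_scope.
#[local] Obligation Tactic := idtac.

Section Quotient.
Variables (T : Type) (R : T -> T -> Prop).

Definition gen_equiv : rel {classic T} :=
  fun x y => `[< clos_refl_sym_trans T R x y >].

Lemma gen_equiv_refl : reflexive gen_equiv.
Proof. by move=> x; apply/asboolP; exact: rst_refl. Qed.

Lemma gen_equiv_sym : symmetric gen_equiv.
Proof. by move=> x y; apply/asboolP/asboolP; exact: rst_sym. Qed.

Lemma gen_equiv_trans : transitive gen_equiv.
Proof.
by move=> y x z /asboolP xy /asboolP yz; apply/asboolP; exact: rst_trans xy yz.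
Qed.

Canonical gen_equiv_rel :=
  EquivRel gen_equiv gen_equiv_refl gen_equiv_sym gen_equiv_trans.

Definition quot : Type := {eq_quot gen_equiv}.

Definition cls (x : T) : quot := \pi_{eq_quot gen_equiv} (x : {classic T}).

Definition quot_lift (U : Type) (f : T -> U) (q : quot) : U :=
  f (repr (q : {eq_quot gen_equiv})).

Lemma cls_eqP x y : cls x = cls y <-> clos_refl_sym_trans T R x y.
Proof. by split => [/eqquotP/asboolP //|xy]; apply/eqquotP/asboolP. Qed.

Lemma cls_eq x y : R x y -> cls x = cls y.
Proof. by move=> xy; apply/cls_eqP; exact: rst_step. Qed.

Lemma quot_ind (P : quot -> Prop) : (forall x, P (cls x)) -> forall q, P q.
Proof. by move=> Pcls q; rewrite -[q]reprK; exact: Pcls. Qed.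

Lemma quot_liftE U (f : T -> U) :
  (forall x y, R x y -> f x = f y) -> forall x, quot_lift f (cls x) = f x.
Proof.
move=> fR x.
have fE y z : clos_refl_sym_trans T R y z -> f y = f z.
  by elim=> {y z} [y z /fR|y|y z _ ->|y z t _ -> _ ->].
by apply: fE; apply/cls_eqP; rewrite /cls reprK.
Qed.

End Quotient.

Record dmap (m n : nat) := DMap {
  dfun :> 'I_m.+1 -> 'I_n.+1;
  dmap_mono : forall i j : 'I_m.+1, i <= j -> dfun i <= dfun j }.

Lemma dmap_eq m n (f g : dmap m n) : f =1 g -> f = g.
Proof.
case: f g => [f fm] [g gm] /= /funext fg; case: _ / fg in gm *.
by congr DMap; exact: Prop_irrelevance.
Qed.

Definition did n : dmap n n := @DMap n n id (fun i j ij => ij).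

Definition dcomp m n p (f : dmap n p) (g : dmap m n) : dmap m p :=
  @DMap m p (f \o g) (fun i j ij => dmap_mono f (dmap_mono g ij)).

Definition dconst m n (i : 'I_n.+1) : dmap m n :=
  @DMap m n (fun=> i) (fun _ _ _ => leqnn i).

Record sSet := SSet {
  simp :> nat -> Type;
  act : forall m n, dmap m n -> simp n -> simp m;
  act_id : forall n (x : simp n), act (did n) x = x;
  act_comp : forall m n p (f : dmap n p) (g : dmap m n) (x : simp p),
    act (dcomp f g) x = act g (act f x) }.

(* the totally degenerate m-simplex on a vertex *)
Definition cst (X : sSet) m (x : X 0) : X m := act (dconst m ord0) x.

Lemma act_cst (X : sSet) m n (f : dmap m n) (x : X 0) :
  act f (cst n x) = cst m x.
Proof. by rewrite /cst -act_comp; congr act; exact: dmap_eq. Qed.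

Lemma cst0 (X : sSet) (x : X 0) : cst 0 x = x.
Proof.
rewrite -[RHS]act_id; congr act; apply: dmap_eq => i.
by rewrite /= [i]ord1.
Qed.

Record sMap (X Y : sSet) := SMap {
  smap :> forall n, X n -> Y n;
  smap_nat : forall m n (f : dmap m n) (x : X n),
    smap (act f x) = act f (smap x) }.

Lemma sMap_eq X Y (f g : sMap X Y) : (forall n x, f n x = g n x) -> f = g.
Proof.
case: f g => [f fn] [g gn] /= fg.
have {}fg : f = g.
  by apply: functional_extensionality_dep => n; apply/funext => x; exact: fg.
by case: _ / fg in gn *; congr SMap; exact: Prop_irrelevance.
Qed.

Definition sid (X : sSet) : sMap X X :=
  @SMap X X (fun _ x => x) (fun _ _ _ _ => erefl).

Program Definition scomp X Y Z (g : sMap Y Z) (f : sMap X Y) : sMap X Z :=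
  @SMap X Z (fun n x => g n (f n x)) _.
Next Obligation. by move=> * /=; rewrite !smap_nat. Qed.

Lemma smap_cst X Y (f : sMap X Y) m x : f m (cst m x) = cst m (f 0 x).
Proof. exact: smap_nat. Qed.

Definition is_siso X Y (f : sMap X Y) :=
  exists g : sMap Y X, scomp g f = sid X /\ scomp f g = sid Y.

Program Definition Delta (n : nat) : sSet :=
  @SSet (fun m => dmap m n) (fun _ _ g f => dcomp f g) _ _.
Next Obligation. by move=> *; exact: dmap_eq. Qed.
Next Obligation. by move=> *; exact: dmap_eq. Qed.

Definition vtx n (i : 'I_n.+1) : Delta n 0 := dconst 0 i.

Program Definition Delta_map m n (f : dmap m n) : sMap (Delta m) (Delta n) :=
  @SMap (Delta m) (Delta n) (fun _ g => dcomp f g) _.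
Next Obligation. by move=> *; exact: dmap_eq. Qed.

(* the map Delta n -> S classifying an n-simplex *)
Program Definition yoneda (S : sSet) n (x : S n) : sMap (Delta n) S :=
  @SMap (Delta n) S (fun _ f => act f x) _.
Next Obligation. by move=> * /=; rewrite -act_comp. Qed.

Section Nerve.
Variables (P : Type) (le : P -> P -> Prop).

Record chain (n : nat) := Chain {
  cfun :> 'I_n.+1 -> P;
  chain_mono : forall i j : 'I_n.+1, i <= j -> le (cfun i) (cfun j) }.

Lemma chain_eq n (c d : chain n) : c =1 d -> c = d.
Proof.
case: c d => [c cm] [d dm] /= /funext cd; case: _ / cd in dm *.
by congr Chain; exact: Prop_irrelevance.
Qed.

Definition chain_act m n (f : dmap m n) (c : chain n) : chain m :=
  @Chain m (c \o f) (fun i j ij => chain_mono c (dmap_mono f ij)).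

Program Definition nerve : sSet := @SSet chain chain_act _ _.
Next Obligation. by move=> *; exact: chain_eq. Qed.
Next Obligation. by move=> *; exact: chain_eq. Qed.

End Nerve.

Record sCat := SCat {
  ob :> Type;
  hom : ob -> ob -> sSet;
  idm : forall x, hom x x 0;
  ecomp : forall x y z n, hom y z n -> hom x y n -> hom x z n;
  ecomp_nat : forall x y z m n (f : dmap m n) (h : hom y z n) (g : hom x y n),
    act f (ecomp h g) = ecomp (act f h) (act f g);
  ecompA : forall x y z t n (h : hom z t n) (g : hom y z n) (f : hom x y n),
    ecomp h (ecomp g f) = ecomp (ecomp h g) f;
  ecomp1m : forall x y n (f : hom x y n), ecomp (cst n (idm y)) f = f;
  ecompm1 : forall x y n (f : hom x y n), ecomp f (cst n (idm x)) = f }.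

Record sFunctor (C D : sCat) := SFunctor {
  fob :> C -> D;
  fhom : forall x y, sMap (hom x y) (hom (fob x) (fob y));
  fhom_id : forall x, fhom x x 0 (idm x) = idm (fob x);
  fhom_comp : forall x y z n (g : hom y z n) (f : hom x y n),
    fhom x z n (ecomp g f) = ecomp (fhom y z n g) (fhom x y n f) }.

Program Definition fcomp C D E (G : sFunctor D E) (F : sFunctor C D) :
    sFunctor C E :=
  @SFunctor C E (G \o F) (fun x y => scomp (fhom G (F x) (F y)) (fhom F x y)) _ _.
Next Obligation. by move=> * /=; rewrite !fhom_id. Qed.
Next Obligation. by move=> * /=; rewrite !fhom_comp. Qed.

(* n-simplices of mapping spaces, bundled with their endpoints in order to
   compare them without transport *)
Record arrow (C : sCat) n := Arrow { asrc : C; atgt : C; aval : hom asrc atgt n }.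
Arguments Arrow {C n asrc atgt}.

Lemma arrow_inj (C : sCat) n (x y : C) (f g : hom x y n) :
  Arrow f = Arrow g -> f = g.
Proof.
have val (u : arrow C n) (e : Arrow f = u) :
    eq_rect _ (fun a => hom a _ n) (eq_rect _ (fun b => hom _ b n) f _ (f_equal (@atgt C n) e))
      _ (f_equal (@asrc C n) e) = aval u.
  by case: _ / e.
move=> e; have /= := val _ e; move: (f_equal _ e) (f_equal _ e) => /= ex ey.
by rewrite (Prop_irrelevance ex erefl) (Prop_irrelevance ey erefl).
Qed.

Lemma sFunctor_eq C D (F G : sFunctor C D) : (forall x, F x = G x) ->
  (forall x y n (f : hom x y n),
     Arrow (fhom F x y n f) = Arrow (fhom G x y n f)) -> F = G.
Proof.
case: F G => [F Fh Fi Fc] [G Gh Gi Gc] /= /funext FG.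
case: _ / FG in Gh Gi Gc * => FGh.
have {}FGh : Fh = Gh.
  apply: functional_extensionality_dep => x.
  apply: functional_extensionality_dep => y.
  by apply: sMap_eq => n f; apply: arrow_inj; exact: FGh.
by case: _ / FGh in Gi Gc *; congr SFunctor; exact: Prop_irrelevance.
Qed.

(* For j < i there is no such subset, since i would satisfy i <= i <= j. *)
Record Pset n (i j : 'I_n.+1) := mkPset {
  pset :> set 'I_n.+1;
  pset_src : pset i;
  pset_tgt : pset j;
  pset_itv : pset `<=` [set k | i <= k <= j] }.

Lemma Pset_eq n (i j : 'I_n.+1) (A B : Pset i j) : A = B :> set _ -> A = B.
Proof.
case: A B => [A a1 a2 a3] [B b1 b2 b3] /= AB; case: _ / AB in b1 b2 b3 *.
by congr mkPset; exact: Prop_irrelevance.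
Qed.

Definition Phom n (i j : 'I_n.+1) : sSet :=
  nerve (fun A B : Pset i j => A `<=` B).

Lemma Phom_eq n (i j : 'I_n.+1) m (c d : Phom i j m) :
  (forall k, c k = d k :> set _) -> c = d.
Proof. by move=> cd; apply: chain_eq => k; apply: Pset_eq. Qed.

Program Definition Pset1 n (i : 'I_n.+1) : Pset i i := @mkPset n i i [set i] _ _ _.
Next Obligation. by []. Qed.
Next Obligation. by []. Qed.
Next Obligation. by move=> n i _ /= ->; rewrite leqnn. Qed.

Lemma Pset_le n (i j : 'I_n.+1) (A : Pset i j) : i <= j.
Proof. by have /andP[] := pset_itv (pset_tgt A). Qed.

Program Definition PsetU n (i j k : 'I_n.+1) (B : Pset j k) (A : Pset i j) :
  Pset i k := @mkPset n i k (B `|` A) _ _ _.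
Next Obligation. by move=> *; right; exact: pset_src. Qed.
Next Obligation. by move=> *; left; exact: pset_tgt. Qed.
Next Obligation.
move=> n i j k B A l [] /pset_itv /= /andP[].
  by move=> jl ->; rewrite andbT; exact: leq_trans (Pset_le A) jl.
by move=> -> lj; exact: leq_trans lj (Pset_le B).
Qed.

Program Definition Pcomp n (i j k : 'I_n.+1) m (d : Phom j k m) (c : Phom i j m) :
  Phom i k m := @Chain _ _ m (fun t => PsetU (d t) (c t)) _.
Next Obligation.
move=> n i j k m d c s t st x /= [dx|cx].
  by left; exact: (chain_mono d st).
by right; exact: (chain_mono c st).
Qed.

Program Definition CDelta (n : nat) : sCat :=
  @SCat 'I_n.+1 (@Phom n) (fun i => @Chain _ _ 0 (fun=> Pset1 i) _) (@Pcomp n) _ _ _ _.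
Next Obligation. by move=> *; exact: subset_refl. Qed.
Next Obligation. by move=> *; exact: Phom_eq. Qed.
Next Obligation. by move=> *; apply: Phom_eq => l /=; rewrite setUA. Qed.
Next Obligation.
move=> n x y m f; apply: Phom_eq => l /=.
by apply/seteqP; split => [k [->|//]|k fk]; [exact: pset_tgt|right].
Qed.
Next Obligation.
move=> n x y m f; apply: Phom_eq => l /=.
by apply/seteqP; split => [k [//|->]|k fk]; [exact: pset_src|left].
Qed.

Program Definition Pset_image m n (f : dmap m n) (i j : 'I_m.+1) (A : Pset i j) :
  Pset (f i) (f j) := @mkPset n (f i) (f j) (f @` A) _ _ _.
Next Obligation. by move=> m n f i j A; exists i => //; exact: pset_src. Qed.
Next Obligation. by move=> m n f i j A; exists j => //; exact: pset_tgt. Qed.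
Next Obligation.
move=> m n f i j A _ [k /pset_itv /= /andP[ik kj] <-] /=.
by apply/andP; split; exact: dmap_mono.
Qed.

Program Definition CDelta_map m n (f : dmap m n) :
    sFunctor (CDelta m) (CDelta n) :=
  @SFunctor (CDelta m) (CDelta n) f
    (fun i j => @SMap (Phom i j) (Phom (f i) (f j))
       (fun p c => @Chain _ _ p (fun t => Pset_image f (c t)) _) _) _ _.
Next Obligation.
by move=> m n f i j p c s t st; apply: image_subset; exact: (chain_mono c st).
Qed.
Next Obligation. by move=> *; exact: Phom_eq. Qed.
Next Obligation. by move=> *; apply: Phom_eq => k /=; rewrite image_set1. Qed.
Next Obligation. by move=> *; apply: Phom_eq => k /=; rewrite image_setU. Qed.

(* A cocone under the diagram sending s : Delta n -> S to CDelta n. *)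
Record cocone (S : sSet) (K : sCat) := Cocone {
  leg : forall n, sMap (Delta n) S -> sFunctor (CDelta n) K;
  leg_nat : forall m n (f : dmap m n) (s : sMap (Delta n) S),
    leg (scomp s (Delta_map f)) = fcomp (leg s) (CDelta_map f) }.

Definition is_colimit S K (c : cocone S K) :=
  forall (L : sCat) (d : cocone S L), exists! F : sFunctor K L,
    forall n (s : sMap (Delta n) S), fcomp F (leg c s) = leg d s.

(* The colimit of the diagram is presented by generators and relations: [rigid S]
   has object set S_0, and the p-simplices of its mapping spaces are the formal
   composites of simplices of the CDelta n, modulo the relations that make it a
   category receiving a cocone.  Lemma [rigidP] is its universal property. *)
Section Rigidification.
Variable S : sSet.

Inductive term (p : nat) : S 0 -> S 0 -> Type :=
| tid a : term p a a
| tcomp a b c : term p b c -> term p a b -> term p a c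
| tgen n (s : sMap (Delta n) S) (i j : 'I_n.+1) a b
    of s 0 (vtx i) = a & s 0 (vtx j) = b & Phom i j p : term p a b.

Inductive term_rel (p : nat) : forall a b, term p a b -> term p a b -> Prop :=
| rel_compl a b c (h h' : term p b c) (g : term p a b) :
    term_rel h h' -> term_rel (tcomp h g) (tcomp h' g)
| rel_compr a b c (h : term p b c) (g g' : term p a b) :
    term_rel g g' -> term_rel (tcomp h g) (tcomp h g')
| rel_assoc a b c d (h : term p c d) (g : term p b c) (f : term p a b) :
    term_rel (tcomp h (tcomp g f)) (tcomp (tcomp h g) f)
| rel_idl a b (f : term p a b) : term_rel (tcomp (tid p b) f) f
| rel_idr a b (f : term p a b) : term_rel (tcomp f (tid p a)) f
| rel_gen_id n (s : sMap (Delta n) S) i a (e e' : s 0 (vtx i) = a) :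
    term_rel (tgen e e' (cst p (idm (i : CDelta n)))) (tid p a)
| rel_gen_comp n (s : sMap (Delta n) S) i j k a b c (ea : s 0 (vtx i) = a)
    (eb : s 0 (vtx j) = b) (ec : s 0 (vtx k) = c)
    (h : Phom j k p) (g : Phom i j p) :
    term_rel (tgen ea ec (Pcomp h g)) (tcomp (tgen eb ec h) (tgen ea eb g))
| rel_gen_map m n (f : dmap m n) (s : sMap (Delta n) S) i j a b
    (ea : scomp s (Delta_map f) 0 (vtx i) = a)
    (eb : scomp s (Delta_map f) 0 (vtx j) = b)
    (ea' : s 0 (vtx (f i)) = a) (eb' : s 0 (vtx (f j)) = b) (g : Phom i j p) :
    term_rel (tgen ea eb g) (tgen ea' eb' (fhom (CDelta_map f) i j p g)).

Fixpoint term_act p q (f : dmap p q) a b (t : term q a b) : term p a b :=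
  match t with
  | tid a => tid p a
  | tcomp _ _ _ h g => tcomp (term_act f h) (term_act f g)
  | tgen _ _ _ _ _ _ ea eb g => tgen ea eb (act f g)
  end.

Lemma term_act_rel p q (f : dmap p q) a b (t u : term q a b) :
  term_rel t u -> term_rel (term_act f t) (term_act f u).
Proof.
elim=> {a b t u} /=; try by constructor.
- move=> n s i j k a b c ea eb ec h g.
  have /= -> := @ecomp_nat (CDelta n) i j k p q f h g.
  by constructor.
- move=> m n g s i j a b ea eb ea' eb' h.
  have /= <- := smap_nat (fhom (CDelta_map g) i j) f h.
  by constructor.
Qed.

Definition rsimp a b p := quot (@term_rel p a b).

Definition rcls a b p (t : term p a b) : rsimp a b p := cls (@term_rel p a b) t.

Lemma rcls_ind a b p (P : rsimp a b p -> Prop) :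
  (forall t, P (rcls t)) -> forall q, P q.
Proof. exact: quot_ind. Qed.

Definition ract a b p q (f : dmap p q) : rsimp a b q -> rsimp a b p :=
  quot_lift (fun t => rcls (term_act f t)).

Lemma ractE a b p q (f : dmap p q) (t : term q a b) :
  ract f (rcls t) = rcls (term_act f t).
Proof.
by apply: (quot_liftE (f := fun t => rcls _)) => u v uv; apply: cls_eq;
  exact: term_act_rel.
Qed.

Program Definition rhom a b : sSet := @SSet (rsimp a b) (@ract a b) _ _.
Next Obligation.
move=> a b n; elim/rcls_ind => t; rewrite ractE; congr rcls.
elim: t => //= [? ? ? ? -> ? ->//|m s i j {}a {}b ea eb c].
by congr tgen; exact: (act_id (s := Phom i j)).
Qed.
Next Obligation.
move=> a b m n p f g; elim/rcls_ind => t.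
rewrite [in RHS](ractE f t) (ractE g) ractE; congr rcls.
by elim: t => //= ? ? ? ? -> ? ->.
Qed.

Lemma rhom_actE a b p q (f : dmap p q) (t : term q a b) :
  act f (rcls t : rhom a b q) = rcls (term_act f t).
Proof. exact: ractE. Qed.

Definition rcomp a b c p (h : rhom b c p) (g : rhom a b p) : rhom a c p :=
  quot_lift (fun u => quot_lift (fun t => rcls (tcomp u t)) g) h.

Lemma rcompE a b c p (u : term p b c) (t : term p a b) :
  rcomp (rcls u) (rcls t) = rcls (tcomp u t).
Proof.
have E u' : quot_lift (fun t => rcls (tcomp u' t)) (rcls t) =
    rcls (tcomp u' t).
  apply: (quot_liftE (f := fun t => rcls (tcomp u' t))) => x y xy.
  by apply: cls_eq; constructor.
rewrite /rcomp -[RHS]E.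
apply: (quot_liftE (f := fun u => quot_lift (fun t => rcls (tcomp u t)) (rcls t))).
move=> x y xy.
have E' u' : quot_lift (fun t => rcls (tcomp u' t)) (rcls t) =
    rcls (tcomp u' t) by exact: E.
by rewrite !E'; apply: cls_eq; constructor.
Qed.

Program Definition rigid : sCat :=
  @SCat (S 0) rhom (fun a => rcls (tid 0 a)) rcomp _ _ _ _.
Next Obligation.
move=> x y z m n f; elim/rcls_ind => h; elim/rcls_ind => g.
by rewrite rcompE !rhom_actE rcompE.
Qed.
Next Obligation.
move=> x y z t n; elim/rcls_ind => h; elim/rcls_ind => g; elim/rcls_ind => f.
by rewrite !rcompE; apply: cls_eq; constructor.
Qed.
Next Obligation.
move=> x y n; elim/rcls_ind => f.
by rewrite /cst rhom_actE rcompE; apply: cls_eq; constructor.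
Qed.
Next Obligation.
move=> x y n; elim/rcls_ind => f.
by rewrite /cst rhom_actE rcompE; apply: cls_eq; constructor.
Qed.

Program Definition rigid_leg n (s : sMap (Delta n) S) : sFunctor (CDelta n) rigid :=
  @SFunctor (CDelta n) rigid (fun i => s 0 (vtx i))
    (fun i j => @SMap (Phom i j) (rhom _ _)
       (fun p c => rcls (tgen erefl erefl c)) _) _ _.
Next Obligation. by move=> *; rewrite /= ractE. Qed.
Next Obligation.
move=> n s i; have := @rel_gen_id 0 n s i _ erefl erefl.
by rewrite cst0 => E; exact: cls_eq E.
Qed.
Next Obligation. by move=> *; rewrite /= rcompE; apply: cls_eq; constructor. Qed.

Program Definition rigid_cocone : cocone S rigid := @Cocone S rigid rigid_leg _.
Next Obligation.
move=> m n f s; have E i : scomp s (Delta_map f) 0 (vtx i) = s 0 (vtx (f i)).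
  by congr (s 0); exact: dmap_eq.
apply: sFunctor_eq => [|i j p c]; first exact: E.
have -> : fhom (rigid_leg (scomp s (Delta_map f))) i j p c =
    rcls (tgen erefl erefl c) by [].
rewrite (_ : Arrow _ = @Arrow rigid p _ _ (rcls (tgen (E i) (E j) c))).
  by congr Arrow; apply: cls_eq; exact: rel_gen_map.
by case: _ / (E i); case: _ / (E j).
Qed.

End Rigidification.

Section UniversalProperty.
Variables (S : sSet) (K : sCat) (d : cocone S K).

Definition castH p (x y x' y' : K) (ex : x = x') (ey : y = y') (f : hom x y p) :
    hom x' y' p :=
  let: erefl := ex in let: erefl := ey in f.

Lemma castHE p x y x' y' (ex : x = x' :> K) (ey : y = y') (f : hom x y p) :
  Arrow (castH ex ey f) = Arrow f.
Proof. by case: _ / ex; case: _ / ey. Qed.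

Lemma act_castH p q (h : dmap p q) x y x' y' (ex : x = x' :> K) (ey : y = y')
  (f : hom x y q) : act h (castH ex ey f) = castH ex ey (act h f).
Proof. by case: _ / ex; case: _ / ey. Qed.

Lemma Arrow_comp p x y z x' y' z' (h : hom y z p) (g : hom x y p)
    (h' : hom y' z' p) (g' : hom x' y' p) : y = y' :> K ->
  Arrow h = Arrow h' -> Arrow g = Arrow g' -> Arrow (ecomp h g) = Arrow (ecomp h' g').
Proof.
move=> ey eh eg.
have ez : z = z' := f_equal (@atgt K p) eh.
have ex : x = x' := f_equal (@asrc K p) eg.
case: _ / ex in g' eg *; case: _ / ez in h' eh *; case: _ / ey in g' h' eh eg *.
by rewrite (arrow_inj eh) (arrow_inj eg).
Qed.

Definition uob (a : S 0) : K := leg d (yoneda a) ord0.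

Lemma uob_leg n (s : sMap (Delta n) S) i : leg d s i = uob (s 0 (vtx i)).
Proof.
rewrite /uob (_ : yoneda _ = scomp s (Delta_map (vtx i))) ?leg_nat//.
by apply: sMap_eq => m f /=; rewrite -smap_nat.
Qed.

Fixpoint teval p a b (t : term p a b) : hom (uob a) (uob b) p :=
  match t with
  | tid a => cst p (idm (uob a))
  | tcomp _ _ _ h g => ecomp (teval h) (teval g)
  | tgen n s i j _ _ ea eb g =>
      castH (etrans (uob_leg s i) (f_equal uob ea))
        (etrans (uob_leg s j) (f_equal uob eb)) (fhom (leg d s) i j p g)
  end.

Lemma teval_rel p a b (t u : term p a b) : term_rel t u -> teval t = teval u.
Proof.
elim=> {a b t u} /=.
- by move=> a b c h h' g _ ->.
- by move=> a b c h g g' _ ->.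
- by move=> *; exact: ecompA.
- by move=> *; exact: ecomp1m.
- by move=> *; exact: ecompm1.
- move=> n s i a e e'; apply: arrow_inj; rewrite castHE.
  rewrite smap_cst fhom_id; have -> : uob a = leg d s i by rewrite -e uob_leg.
  by [].
- move=> n s i j k a b c ea eb ec h g; apply: arrow_inj.
  rewrite castHE (fhom_comp (leg d s) (x := i) (y := j) (z := k)).
  by apply: Arrow_comp; rewrite ?castHE// -eb uob_leg.
- move=> m n f s i j a b ea eb ea' eb' g; apply: arrow_inj.
  by rewrite !castHE leg_nat.
Qed.

Lemma teval_act p q (f : dmap p q) a b (t : term q a b) :
  teval (term_act f t) = act f (teval t).
Proof.
elim: t => {a b} /= [a|a b c h -> g ->|n s i j a b ea eb g].
- by rewrite act_cst.
- by rewrite ecomp_nat.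
- by rewrite act_castH -smap_nat.
Qed.

Definition uhom a b p : rhom a b p -> hom (uob a) (uob b) p :=
  quot_lift (@teval p a b).

Lemma uhomE a b p (t : term p a b) : uhom (rcls t) = teval t.
Proof. by apply: quot_liftE; exact: teval_rel. Qed.

Program Definition ufun : sFunctor (rigid S) K :=
  @SFunctor (rigid S) K uob (fun a b => @SMap (rhom a b) _ (@uhom a b) _) _ _.
Next Obligation.
by move=> a b m n f; elim/rcls_ind => t; rewrite rhom_actE !uhomE teval_act.
Qed.
Next Obligation. by move=> a /=; rewrite uhomE /= cst0. Qed.
Next Obligation.
move=> a b c n; elim/rcls_ind => h; elim/rcls_ind => g /=.
by rewrite rcompE !uhomE.
Qed.

Lemma ufunP n (s : sMap (Delta n) S) : fcomp ufun (rigid_leg s) = leg d s.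
Proof.
apply: sFunctor_eq => [i|i j p c] /=; first by rewrite -uob_leg.
by rewrite uhomE /= castHE.
Qed.

Lemma ufun_uniq (F : sFunctor (rigid S) K) :
  (forall n (s : sMap (Delta n) S), fcomp F (rigid_leg s) = leg d s) -> ufun = F.
Proof.
move=> FE; have obE a : uob a = F a.
  rewrite /uob -FE /=; congr (F _).
  by rewrite -[RHS]act_id; congr act; apply: dmap_eq => i; rewrite /= [i]ord1.
apply: sFunctor_eq => // a b p; elim/rcls_ind => t /=; rewrite uhomE.
elim: t => {a b} /= [a|a b c h IHh g IHg|n s i j a b ea eb c].
- have -> : rcls (tid p a) = cst p (idm (a : rigid S)) by rewrite /cst rhom_actE.
  by rewrite smap_cst fhom_id obE.
- by rewrite -rcompE (fhom_comp F (x := a) (y := b) (z := c)); exact: Arrow_comp.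
- rewrite castHE -FE; case: _ / ea; case: _ / eb; by [].
Qed.

End UniversalProperty.

Theorem rigidP (S : sSet) : is_colimit (rigid_cocone S).
Proof.
move=> L d; exists (ufun d); split; first exact: ufunP.
by move=> F; exact: ufun_uniq.
Qed.

Record bpSet := BPSet { carrier :> sSet; alpha : carrier 0; omega : carrier 0 }.

Definition simplex n : bpSet := BPSet (vtx (ord0 : 'I_n.+1)) (vtx (ord_max : 'I_n.+1)).

(* [wedge X Y] is the pushout of X <- Delta 0 -> Y along omega X and alpha Y. *)
Section Wedge.
Variables X Y : bpSet.

Variant glue m : X m + Y m -> X m + Y m -> Prop :=
| Glue : glue (inl (cst m (omega X))) (inr (cst m (alpha Y))).

Definition wsimp m := quot (@glue m).

Definition sum_act m n (f : dmap m n) (z : X n + Y n) : X m + Y m :=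
  match z with inl x => inl (act f x) | inr y => inr (act f y) end.

Definition wact m n (f : dmap m n) : wsimp n -> wsimp m :=
  quot_lift (fun z => cls (@glue m) (sum_act f z)).

Lemma wactE m n (f : dmap m n) z :
  wact f (cls (@glue n) z) = cls (@glue m) (sum_act f z).
Proof.
apply: (quot_liftE (f := fun z => cls _ _)) => _ _ [] /=.
by rewrite !act_cst; apply: cls_eq.
Qed.

Program Definition wset : sSet := @SSet wsimp wact _ _.
Next Obligation.
by move=> n; elim/quot_ind => z; rewrite wactE; case: z => z /=; rewrite act_id.
Qed.
Next Obligation.
move=> m n p f g; elim/quot_ind => z.
rewrite [in RHS](wactE f z) (wactE g) wactE.
by case: z => z /=; rewrite act_comp.
Qed.

Program Definition winl : sMap X wset :=
  @SMap X wset (fun m x => cls (@glue m) (inl x)) _.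
Next Obligation. by move=> m n f x; rewrite /= wactE. Qed.

Program Definition winr : sMap Y wset :=
  @SMap Y wset (fun m y => cls (@glue m) (inr y)) _.
Next Obligation. by move=> m n f x; rewrite /= wactE. Qed.

Definition wedge : bpSet := @BPSet wset (winl 0 (alpha X)) (winr 0 (omega Y)).

Lemma wglue : winl 0 (omega X) = winr 0 (alpha Y).
Proof.
by apply: cls_eq; rewrite -[omega X]cst0 -[alpha Y]cst0; exact: Glue.
Qed.

Section Case.
Variables (Z : sSet) (f : sMap X Z) (g : sMap Y Z).
Hypothesis fg : f 0 (omega X) = g 0 (alpha Y).

Definition sum_case m (z : X m + Y m) : Z m :=
  match z with inl x => f m x | inr y => g m y end.

Lemma sum_caseE m z : quot_lift (@sum_case m) (cls (@glue m) z) = sum_case z.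
Proof. by apply: quot_liftE => _ _ [] /=; rewrite !smap_cst fg. Qed.

Program Definition wcase : sMap wedge Z :=
  @SMap wset Z (fun m => quot_lift (@sum_case m)) _.
Next Obligation.
move=> m n h; elim/quot_ind => z /=.
by rewrite wactE !sum_caseE; case: z => z /=; rewrite smap_nat.
Qed.

Lemma wcase_inl m x : wcase m (winl m x) = f m x.
Proof. exact: (sum_caseE (inl x)). Qed.

Lemma wcase_inr m y : wcase m (winr m y) = g m y.
Proof. exact: (sum_caseE (inr y)). Qed.

Lemma wcase_uniq (h : sMap wedge Z) :
  scomp h winl = f -> scomp h winr = g -> h = wcase.
Proof.
move=> hf hg; apply: sMap_eq => m; elim/quot_ind => -[x|y].
  by rewrite (wcase_inl x) -hf.
by rewrite (wcase_inr y) -hg.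
Qed.

End Case.
End Wedge.

(* A necklace is an iterated wedge of simplices with an arbitrary bracketing:
   the wedge is associative up to isomorphism, and flagged necklaces over S that
   are isomorphic are identified in [neck_hom].  Beads of dimension 0 are allowed; they do not
   change the set of joints, so that no preferred form has to be singled out. *)
Inductive necklace : Type :=
| bead of nat
| join of necklace & necklace.

Fixpoint real (T : necklace) : bpSet :=
  match T with
  | bead n => simplex n
  | join U V => wedge (real U) (real V)
  end.

Coercion real : necklace >-> bpSet.

Fixpoint joints (T : necklace) : set (real T 0) :=
  match T return set (real T 0) with
  | bead n => [set alpha (simplex n); omega (simplex n)]
  | join U V =>
      winl (real U) (real V) 0 @` @joints U `|`
      winr (real U) (real V) 0 @` @joints V
  end.
Arguments joints : clear implicits.

Section NecklaceHom.
Variables (S : sSet) (a b : S 0).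

Record flagged n := Flagged {
  neck : necklace;
  nmap : sMap neck S;
  nmap_src : nmap 0 (alpha neck) = a;
  nmap_tgt : nmap 0 (omega neck) = b;
  flag : 'I_n.+1 -> set (neck 0);
  flag_mono : forall i j : 'I_n.+1, i <= j -> flag i `<=` flag j;
  flag_joints : joints neck `<=` flag ord0 }.
Arguments flag {n} f i.

Definition flag_map n (t u : flagged n) : Prop :=
  exists f : sMap (neck t) (neck u),
    [/\ f 0 (alpha (neck t)) = alpha (neck u),
        f 0 (omega (neck t)) = omega (neck u),
        scomp (nmap u) f = nmap t
      & forall i, flag u i = f 0 @` flag t i].

(* Coface maps omit a term of the flag, codegeneracies repeat one. *)
Program Definition flagged_act m n (h : dmap m n) (t : flagged n) : flagged m :=
  @Flagged m (neck t) (nmap t) (nmap_src t) (nmap_tgt t) (flag t \o h) _ _.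
Next Obligation.
by move=> m n h t i j ij; apply: flag_mono; exact: dmap_mono.
Qed.
Next Obligation.
move=> m n h t; apply: subset_trans (@flag_joints _ t) _.
exact: flag_mono.
Qed.

Definition neck_cls n (t : flagged n) : quot (@flag_map n) := cls (@flag_map n) t.

Definition neck_act m n (h : dmap m n) :
    quot (@flag_map n) -> quot (@flag_map m) :=
  quot_lift (fun t => neck_cls (flagged_act h t)).

Lemma neck_actE m n (h : dmap m n) (t : flagged n) :
  neck_act h (neck_cls t) = neck_cls (flagged_act h t).
Proof.
apply: (quot_liftE (f := fun t => neck_cls _)) => u v [f [fa fo fS fl]].
by apply: cls_eq; exists f; split => // i; exact: fl.
Qed.

Program Definition neck_hom : sSet := @SSet (fun n => quot (@flag_map n)) neck_act _ _.
Next Obligation.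
move=> n; elim/quot_ind => t; rewrite neck_actE; congr cls.
case: t => T f fa fb F Fm Fj; rewrite /flagged_act /=.
by congr Flagged; exact: Prop_irrelevance.
Qed.
Next Obligation.
move=> m n p f g; elim/quot_ind => t.
rewrite [in RHS](neck_actE f t) (neck_actE g) neck_actE; congr cls.
by rewrite /flagged_act /=; congr Flagged; exact: Prop_irrelevance.
Qed.

End NecklaceHom.
Arguments flag {S a b n} f i.

Section NecklaceComp.
Variables (S : sSet) (a b c : S 0) (n : nat).
Variables (t : flagged b c n) (u : flagged a b n).

Definition nmap_comp : sMap (join (neck u) (neck t)) S :=
  wcase (etrans (nmap_tgt u) (esym (nmap_src t))).

Definition flag_comp (i : 'I_n.+1) : set (join (neck u) (neck t) 0) :=
  winl (neck u) (neck t) 0 @` flag u i `|` winr (neck u) (neck t) 0 @` flag t i.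

Program Definition flagged_comp : flagged a c n :=
  @Flagged S a c n (join (neck u) (neck t)) nmap_comp _ _ flag_comp _ _.
Next Obligation. by rewrite wcase_inl nmap_src. Qed.
Next Obligation. by rewrite wcase_inr nmap_tgt. Qed.
Next Obligation.
by move=> i j ij; apply: setUSS; apply: image_subset; exact: flag_mono.
Qed.
Next Obligation.
by apply: setUSS; apply: image_subset; exact: flag_joints.
Qed.

End NecklaceComp.

(* A chain of subsets of {0, ..., n} containing 0 and n is the same thing as a
   flag on the one-bead necklace [bead n]. *)
Program Definition flagged_simplex S n (s : sMap (Delta n) S) m
    (c : Phom (ord0 : 'I_n.+1) (ord_max : 'I_n.+1) m) :
    flagged (s 0 (vtx ord0)) (s 0 (vtx ord_max)) m :=
  @Flagged S _ _ m (bead n) s erefl erefl (fun i => @vtx n @` c i) _ _.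
Next Obligation.
by move=> S n s m c i j ij; apply: image_subset; exact: (chain_mono c ij).
Qed.
Next Obligation.
move=> S n s m c _ [->|->]; first by exists ord0 => //; exact: pset_src.
by exists ord_max => //; exact: pset_tgt.
Qed.

(* Main.v *)
Require Import Defs.
From mathcomp Require Import all_boot.
From mathcomp Require Import boolp classical_sets.
From mathcomp Require Import zify.

(** The rigidification of [S] is presented by generators and relations: a
    p-simplex of a mapping space is a formal composite of chains of vertex
    sets of simplices of [S].  A flagged necklace over [S] yields such a
    composite, one factor for each bead ([flagged_term]), and conversely each
    formal composite describes a flagged necklace: a generator, a chain of
    subsets of the interval from i to j, becomes one bead spanned by that
    interval, and composites become wedges ([term_flagged]).  That the second
    construction respects the relations of the presentation is checked
    relation by relation; apart from the two congruences, each one is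
    witnessed by an explicit map of necklaces ([term_flagged_rel]).  The two
    constructions are visibly inverse to each other ([flagged_term_flagged],
    [term_flaggedK]), and the first turns wedges into composites
    ([flagged_term_comp]).

    What has to be explained is that a map of necklaces f : T -> U over [S]
    does not change the composite ([flagged_term_map]), since f may send a
    bead of T into the middle of a bead of U, or collapse it onto a joint.
    Both composites are the images under U -> S of composites over U, which
    have the same endpoints and involve the same sets of vertices of U.  So it
    suffices that in the rigidification of a necklace a simplex is determined
    by its endpoints and its flag of vertex sets ([necklace_flag_determined]);
    that is, that its mapping spaces are subcomplexes of nerves of posets of
    vertex sets.

    This is proved by induction on the necklace.  For one simplex, every
    formal composite reduces to a single generator ([Delta_term]).  For a
    wedge of X and Y, let rL and rR be the retractions onto X and Y that
    collapse the other part to the joint.  A composite t from a vertex of X to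
    a vertex of Y equals (rR t) after (rL t), a composite between two vertices
    of X equals rL t, and similarly for Y ([term_factors]); so t is determined
    by rL t and rR t, hence by its flag.  The factorization needs that nothing
    but the identity ends at the first vertex of a necklace or starts at its
    last vertex ([necklace_initial], [necklace_terminal]), so that a composite
    cannot pass through the joint and come back. *)

Set Implicit Arguments.
Unset Strict Implicit.
Unset Printing Implicit Defensive.

Local Open Scope classical_set_scope.
#[local] Obligation Tactic := idtac.

(** * Formal composites up to the relations *)

Section Arrows.
Variables (S : sSet) (p : nat).
Implicit Types a b c : S 0.

(** Endpoints of terms are often equal without being convertible.  Bundling
    the endpoints with the class of a term gives a notion of equality that
    needs no transport. *)
Definition arr a b (t : term p a b) : arrow (rigid S) p :=
  @Arrow (rigid S) p a b (rcls t).

Lemma arr_rcls a b (t u : term p a b) : arr t = arr u -> rcls t = rcls u.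
Proof. exact: (@arrow_inj (rigid S) p a b). Qed.

Lemma arr_src a b a' b' (t : term p a b) (u : term p a' b') :
  arr t = arr u -> a = a'.
Proof. exact: (f_equal (@asrc (rigid S) p)). Qed.

Lemma arr_tgt a b a' b' (t : term p a b) (u : term p a' b') :
  arr t = arr u -> b = b'.
Proof. exact: (f_equal (@atgt (rigid S) p)). Qed.

Lemma arr_rel a b (t u : term p a b) : term_rel t u -> arr t = arr u.
Proof. by move=> tu; congr Arrow; exact: cls_eq. Qed.

Lemma arr_comp a b c a' b' c' (h : term p b c) (g : term p a b)
    (h' : term p b' c') (g' : term p a' b') :
  arr h = arr h' -> arr g = arr g' -> arr (tcomp h g) = arr (tcomp h' g').
Proof.
move=> eh eg; rewrite /arr -!rcompE.
exact: (@Arrow_comp (rigid S) _ _ _ _ _ _ _ _ _ _ _ (arr_src eh) eh eg).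
Qed.

Lemma arr_tid a b : a = b -> arr (tid p a) = arr (tid p b).
Proof. by move->. Qed.

Lemma arr_idl a b x y (g : term p a b) (h : term p b x) :
  arr h = arr (tid p y) -> arr (tcomp h g) = arr g.
Proof.
move=> eh; have yb := arr_src eh; case: _ / yb in eh *.
rewrite (arr_comp (h' := tid p b) (g' := g) eh erefl).
by apply: arr_rel; constructor.
Qed.

Lemma arr_idr a b x y (g : term p a b) (h : term p x a) :
  arr h = arr (tid p y) -> arr (tcomp g h) = arr g.
Proof.
move=> eh; have ya := arr_tgt eh; case: _ / ya in eh *.
rewrite (arr_comp (h' := g) (g' := tid p a) erefl eh).
by apply: arr_rel; constructor.
Qed.

Lemma arr_assoc a b c d (h : term p c d) (g : term p b c) (f : term p a b) :
  arr (tcomp h (tcomp g f)) = arr (tcomp (tcomp h g) f).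
Proof. by apply: arr_rel; constructor. Qed.

(** The naturality relation [rel_gen_map], with all the data that it
    determines replaced by equal ones: the form in which it unifies with
    actual goals. *)
Lemma arr_push m n (f : dmap m n) (s : sMap (Delta n) S) (s' : sMap (Delta m) S)
    i j i' j' a b a' b' (ea : s' 0 (vtx i) = a) (eb : s' 0 (vtx j) = b)
    (ea' : s 0 (vtx i') = a') (eb' : s 0 (vtx j') = b')
    (c : Phom i j p) (c' : Phom i' j' p) :
  s' = scomp s (Delta_map f) -> f i = i' -> f j = j' ->
  (forall k, f @` c k = c' k) ->
  arr (tgen ea eb c) = arr (tgen ea' eb' c').
Proof.
move=> es ei ej; case: _ / ei in c' ea' *; case: _ / ej in c' eb' * => ec.
case: _ / (esym es) in ea eb *.
have -> : c' = fhom (CDelta_map f) i j p c by apply: Phom_eq => k; rewrite -ec.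
have E l : scomp s (Delta_map f) 0 (vtx l) = s 0 (vtx (f l)).
  by congr (s 0); exact: dmap_eq.
have aa : a = a' by rewrite -ea -ea' E.
have bb : b = b' by rewrite -eb -eb' E.
case: _ / aa in ea' *; case: _ / bb in eb' *.
by apply: arr_rel; constructor.
Qed.

Lemma arr_gen n (s s' : sMap (Delta n) S) i j i' j' a b a' b'
    (ea : s' 0 (vtx i) = a) (eb : s' 0 (vtx j) = b)
    (ea' : s 0 (vtx i') = a') (eb' : s 0 (vtx j') = b')
    (c : Phom i j p) (c' : Phom i' j' p) :
  s' = s -> i = i' -> j = j' -> (forall k, c k = c' k :> set _) ->
  arr (tgen ea eb c) = arr (tgen ea' eb' c').
Proof.
move=> es ei ej ec; apply: (arr_push (f := did n)) => // [|k].
  by rewrite es; apply: sMap_eq => m x; congr (s m); exact: dmap_eq.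
by rewrite image_id.
Qed.

(** The only subset of an interval with one element that contains its
    endpoints is the whole interval, so such a generator comes from an
    identity. *)
Lemma arr_gen_id n (s : sMap (Delta n) S) i j a b
    (ea : s 0 (vtx i) = a) (eb : s 0 (vtx j) = b) (c : Phom i j p) :
  i = j -> arr (tgen ea eb c) = arr (tid p a).
Proof.
move=> ij; case: _ / ij in c eb *; case: _ / eb in ea *; case: _ / ea.
suff -> : c = cst p (idm (i : CDelta n)) by apply: arr_rel; constructor.
apply: Phom_eq => k; apply/seteqP; split => l /=.
  by move=> /pset_itv /= il; apply: val_inj => /=; lia.
by move=> ->; exact: pset_src.
Qed.

Fixpoint term_flag a b (t : term p a b) (k : 'I_p.+1) : set (S 0) :=
  match t with
  | tid a => [set a]
  | tcomp _ _ _ h g => term_flag h k `|` term_flag g k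
  | @tgen _ _ n s i j _ _ _ _ c => (fun l => s 0 (vtx l)) @` c k
  end.

Lemma term_flag_src a b (t : term p a b) k : term_flag t k a.
Proof.
elim: t => {a b} //= [a b c h _ g ag|n s i j a b ea eb c]; first by right.
by exists i => //; exact: pset_src.
Qed.

Lemma term_flag_tgt a b (t : term p a b) k : term_flag t k b.
Proof.
elim: t => {a b} //= [a b c h ag g _|n s i j a b ea eb c]; first by left.
by exists j => //; exact: pset_tgt.
Qed.

(** Composition is the union of vertex sets, and the identities add only a
    vertex that is an endpoint of the other factor, hence already in its flag. *)
Lemma term_flag_rel a b (t u : term p a b) :
  term_rel t u -> term_flag t = term_flag u.
Proof.
elim=> {a b t u} /=.
- by move=> a b c h h' g _ E; apply/funext => k /=; rewrite E.
- by move=> a b c h g g' _ E; apply/funext => k /=; rewrite E.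
- by move=> *; apply/funext => k /=; rewrite setUA.
- move=> a b f; apply/funext => k /=; apply/seteqP; split; last by right.
  by move=> x [->|//]; exact: term_flag_tgt.
- move=> a b f; apply/funext => k /=; apply/seteqP; split; last by left.
  by move=> x [//|->]; exact: term_flag_src.
- by move=> n s i a e e'; apply/funext => k /=; rewrite image_set1 e.
- by move=> *; apply/funext => k /=; rewrite image_setU.
- move=> m n f s i j a b ea eb ea' eb' g; apply/funext => k /=.
  rewrite [RHS]image_comp; apply: eq_imagel => l _ /=.
  by congr (s 0); exact: dmap_eq.
Qed.

Lemma term_flag_arr a b a' b' (t : term p a b) (u : term p a' b') :
  arr t = arr u -> term_flag t = term_flag u.
Proof.
move=> tu; have aa := arr_src tu; have bb := arr_tgt tu.
case: _ / aa in u tu *; case: _ / bb in u tu *.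
move/arr_rcls/cls_eqP: tu.
by elim=> {t u} [t u /term_flag_rel|t|t u _ ->|t u v _ -> _ ->].
Qed.

End Arrows.

Section TermMap.
Variables (S S' : sSet) (f : sMap S S') (p : nat).

Fixpoint term_map a b (t : term p a b) : term p (f 0 a) (f 0 b) :=
  match t with
  | tid a => tid p (f 0 a)
  | tcomp _ _ _ h g => tcomp (term_map h) (term_map g)
  | @tgen _ _ n s i j _ _ ea eb c =>
      @tgen S' p n (scomp f s) i j _ _ (f_equal (f 0) ea) (f_equal (f 0) eb) c
  end.

Lemma term_map_rel a b (t u : term p a b) :
  term_rel t u -> arr (term_map t) = arr (term_map u).
Proof.
elim=> {a b t u} /=; try by move=> *; apply: arr_rel; constructor.
- by move=> *; exact: arr_comp.
- by move=> *; exact: arr_comp.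
- by move=> m n g *; apply: (arr_push (f := g)) => //; exact: sMap_eq.
Qed.

Lemma arr_map a b a' b' (t : term p a b) (u : term p a' b') :
  arr t = arr u -> arr (term_map t) = arr (term_map u).
Proof.
move=> tu; have aa := arr_src tu; have bb := arr_tgt tu.
case: _ / aa in u tu *; case: _ / bb in u tu *.
move/arr_rcls/cls_eqP: tu.
by elim=> {t u} [t u /term_map_rel|t|t u _ ->|t u v _ -> _ ->].
Qed.

Lemma term_flag_map a b (t : term p a b) k :
  term_flag (term_map t) k = f 0 @` term_flag t k.
Proof.
elim: t => {a b} /= [a|a b c h -> g ->|n s i j a b ea eb c].
- by rewrite image_set1.
- by rewrite image_setU.
- by rewrite image_comp.
Qed.

End TermMap.

Lemma arr_map_comp (S S' S'' : sSet) (g : sMap S' S'') (f : sMap S S') p a b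
    (t : term p a b) :
  arr (term_map g (term_map f t)) = arr (term_map (scomp g f) t).
Proof.
elim: t => {a b} /= [//|a b c h ? k ?|n s i j a b ea eb c].
  exact: arr_comp.
by apply: arr_gen => //; exact: sMap_eq.
Qed.

Lemma arr_map_id S p a b (t : term p a b) : arr (term_map (sid S) t) = arr t.
Proof.
elim: t => {a b} /= [//|a b c h ? k ?|n s i j a b ea eb c].
  exact: arr_comp.
by apply: arr_gen => //; exact: sMap_eq.
Qed.

(** * The two retractions of a wedge *)

Section WedgeRetractions.
Variables X Y : bpSet.

Definition sconst (A B : sSet) (x : B 0) : sMap A B :=
  @SMap A B (fun m _ => cst m x) (fun m n f _ => esym (act_cst f x)).

(** Both retractions are defined by the universal property of the wedge: the
    identity on one side, the constant map at the joint on the other. *)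
Definition wretl : sMap (wedge X Y) X :=
  @wcase X Y X (sid X) (sconst Y (omega X)) (esym (cst0 (omega X))).

Definition wretr : sMap (wedge X Y) Y :=
  @wcase X Y Y (sconst X (alpha Y)) (sid Y) (cst0 (alpha Y)).

Lemma wretlK m x : wretl m (winl X Y m x) = x.
Proof. by rewrite wcase_inl. Qed.

Lemma wretrK m y : wretr m (winr X Y m y) = y.
Proof. by rewrite wcase_inr. Qed.

Lemma winl_inj m : injective (winl X Y m).
Proof. exact: can_inj (@wretlK m). Qed.

Lemma winr_inj m : injective (winr X Y m).
Proof. exact: can_inj (@wretrK m). Qed.

Lemma winlr_eq x y : winl X Y 0 x = winr X Y 0 y -> x = omega X /\ y = alpha Y.
Proof.
move=> xy; split.
  by rewrite -[x]wretlK xy wcase_inr /= cst0.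
by rewrite -[y]wretrK -xy wcase_inl /= cst0.
Qed.

Lemma wedge_cover m (z : wedge X Y m) :
  (exists x, z = winl X Y m x) \/ (exists y, z = winr X Y m y).
Proof. by elim/quot_ind: z => -[x|y]; [left; exists x|right; exists y]. Qed.

(** A map from a simplex is determined by the image of its top simplex, which
    lies in one of the two sides. *)
Lemma wedge_simplex n (s : sMap (Delta n) (wedge X Y)) :
  (exists s', s = scomp (winl X Y) s') \/ (exists s', s = scomp (winr X Y) s').
Proof.
have sE (Z : sSet) (f : sMap Z (wedge X Y)) z :
    s n (did n) = f n z -> s = scomp f (yoneda z).
  move=> sz; apply: sMap_eq => m g /=.
  rewrite smap_nat -sz -smap_nat; congr (s m); exact: dmap_eq.
case: (wedge_cover (s n (did n))) => -[z /sE ->].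
  by left; exists (yoneda z).
by right; exists (yoneda z).
Qed.

End WedgeRetractions.

(** * The extreme vertices of a necklace *)

Section Ends.

(** No simplex of a mapping space ends at the first vertex, except degenerate
    identities.  Stated for generators, from which it passes to composites. *)
Definition initial_end (X : bpSet) :=
  forall p n (s : sMap (Delta n) X) i j a b
    (ea : s 0 (vtx i) = a) (eb : s 0 (vtx j) = b) (c : Phom i j p),
  b = alpha X -> arr (tgen ea eb c) = arr (tid p (alpha X)).

Definition terminal_end (X : bpSet) :=
  forall p n (s : sMap (Delta n) X) i j a b
    (ea : s 0 (vtx i) = a) (eb : s 0 (vtx j) = b) (c : Phom i j p),
  a = omega X -> arr (tgen ea eb c) = arr (tid p (omega X)).

Lemma initial_end_term (X : bpSet) : initial_end X ->
  forall p a b (t : term p a b), b = alpha X -> arr t = arr (tid p (alpha X)).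
Proof.
move=> Xi p a b; elim=> {a b} [a -> //|a b c h IHh g IHg /IHh h1|].
  have /IHg g1 := arr_src h1.
  by rewrite (arr_comp h1 g1) (arr_idl _ erefl).
by move=> *; exact: Xi.
Qed.

Lemma terminal_end_term (X : bpSet) : terminal_end X ->
  forall p a b (t : term p a b), a = omega X -> arr t = arr (tid p (omega X)).
Proof.
move=> Xi p a b; elim=> {a b} [a -> //|a b c h IHh g IHg /IHg g1|].
  have /IHh h1 := arr_tgt g1.
  by rewrite (arr_comp h1 g1) (arr_idl _ erefl).
by move=> *; exact: Xi.
Qed.

Lemma smap_Delta m n (s : sMap (Delta m) (Delta n)) :
  s = scomp (sid (Delta n)) (Delta_map (s m (did m))).
Proof.
apply: sMap_eq => k g /=.
have -> : dcomp (s m (did m)) g = act (s := Delta n) g (s m (did m)) by [].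
by rewrite -smap_nat; congr (s k); exact: dmap_eq.
Qed.

Lemma vtx_inj n : injective (@vtx n).
Proof. by move=> i j /(congr1 (fun f : dmap 0 n => f ord0)). Qed.

Lemma vtxE n (x : Delta n 0) : x = vtx ((x : dmap 0 n) ord0).
Proof. by apply: dmap_eq => i /=; rewrite [i]ord1. Qed.

Lemma smap_vtx m n (s : sMap (Delta m) (Delta n)) i :
  s 0 (vtx i) = vtx ((s m (did m) : dmap m n) i).
Proof. by rewrite [in LHS](smap_Delta s); exact: dmap_eq. Qed.

Lemma arr_gen_Delta p m n (s : sMap (Delta m) (Delta n)) i j a b
    (ea : s 0 (vtx i) = a) (eb : s 0 (vtx j) = b) (c : Phom i j p) :
  let f : dmap m n := s m (did m) in
  arr (tgen ea eb c) = arr (@tgen (Delta n) p n (sid _) (f i) (f j) _ _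
    erefl erefl (fhom (CDelta_map f) i j p c)).
Proof. by move=> f; apply: (arr_push (f := f)) => //; exact: smap_Delta. Qed.

(** The vertices are ordered along each edge and the first vertex is the
    smallest, so the source of the generator is mapped to the same vertex as
    its target. *)
Lemma bead_initial n : initial_end (bead n).
Proof.
move=> p m s i j a b ea eb c b0.
have ij := Pset_le (c ord0).
have fj : (s m (did m) : dmap m n) j = ord0.
  by apply: vtx_inj; rewrite -smap_vtx eb b0.
have fi : (s m (did m) : dmap m n) i = ord0.
  by apply/val_inj/eqP; rewrite -leqn0 -[0]/(val (@ord0 n)) -fj dmap_mono.
by rewrite arr_gen_Delta arr_gen_id ?fi ?fj.
Qed.

Lemma bead_terminal n : terminal_end (bead n).
Proof.
move=> p m s i j a b ea eb c b0.
have ij := Pset_le (c ord0).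
have fi : (s m (did m) : dmap m n) i = ord_max.
  by apply: vtx_inj; rewrite -smap_vtx ea b0.
have fj : (s m (did m) : dmap m n) j = ord_max.
  apply/val_inj/eqP; rewrite eqn_leq leq_ord.
  by rewrite -[X in X <= _]/(val (@ord_max n)) -fi dmap_mono.
by rewrite arr_gen_Delta arr_gen_id ?fi ?fj.
Qed.

Lemma arr_gen_map p (Z Z' : sSet) (f : sMap Z Z') n (s' : sMap (Delta n) Z)
    (s : sMap (Delta n) Z') i j a b
    (ea : s 0 (vtx i) = a) (eb : s 0 (vtx j) = b) (c : Phom i j p) :
  s = scomp f s' ->
  arr (tgen ea eb c) = arr (term_map f (@tgen Z p n s' i j _ _ erefl erefl c)).
Proof. by move=> es; apply: arr_gen. Qed.

(** A simplex of the right side that ends at the first vertex of the wedge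
    ends at the joint, which is then also the first vertex of the left side. *)
Lemma wedge_initial X Y :
  initial_end X -> initial_end Y -> initial_end (wedge X Y).
Proof.
move=> Xi Yi p n s i j a b ea eb c b0.
case: (wedge_simplex s) => -[s' es]; rewrite (arr_gen_map ea eb c es).
  have s'j : s' 0 (vtx j) = alpha X.
    by apply: (@winl_inj X Y); rewrite -[RHS]b0 -eb es.
  exact: (arr_map (winl X Y) (Xi _ _ _ _ _ _ _ erefl erefl c s'j)).
have /esym/winlr_eq[ax s'j] : winr X Y 0 (s' 0 (vtx j)) = winl X Y 0 (alpha X).
  by rewrite -[RHS]b0 -eb es.
apply: etrans (arr_map (winr X Y) (Yi _ _ _ _ _ _ _ erefl erefl c s'j)) _.
by apply: (@arr_tid (wedge X Y)); rewrite -wglue -ax.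
Qed.

Lemma wedge_terminal X Y :
  terminal_end X -> terminal_end Y -> terminal_end (wedge X Y).
Proof.
move=> Xi Yi p n s i j a b ea eb c b0.
case: (wedge_simplex s) => -[s' es]; rewrite (arr_gen_map ea eb c es); last first.
  have s'i : s' 0 (vtx i) = omega Y.
    by apply: (@winr_inj X Y); rewrite -[RHS]b0 -ea es.
  exact: (arr_map (winr X Y) (Yi _ _ _ _ _ _ _ erefl erefl c s'i)).
have /winlr_eq[s'i ax] : winl X Y 0 (s' 0 (vtx i)) = winr X Y 0 (omega Y).
  by rewrite -[RHS]b0 -ea es.
apply: etrans (arr_map (winl X Y) (Xi _ _ _ _ _ _ _ erefl erefl c s'i)) _.
by apply: (@arr_tid (wedge X Y)); rewrite wglue -ax.
Qed.

Lemma necklace_initial (T : necklace) : initial_end T.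
Proof. by elim: T => [n|U ? V ?]; [exact: bead_initial|exact: wedge_initial]. Qed.

Lemma necklace_terminal (T : necklace) : terminal_end T.
Proof. by elim: T => [n|U ? V ?]; [exact: bead_terminal|exact: wedge_terminal]. Qed.

End Ends.

(** * Composites over a wedge factor through the joint *)

Section WedgeFactor.
Variables (X Y : bpSet) (p : nat).
Hypotheses (Xt : terminal_end X) (Yi : initial_end Y).

Let W := wedge X Y.
Let L : sMap X W := winl X Y.
Let R : sMap Y W := winr X Y.
Let rL : sMap W X := wretl X Y.
Let rR : sMap W Y := wretr X Y.
Let inL (a : W 0) := exists x, a = L 0 x.
Let inR (a : W 0) := exists y, a = R 0 y.

Lemma joint_inLR a : inL a -> inR a -> a = L 0 (omega X) /\ a = R 0 (alpha Y).
Proof.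
move=> [x ->] [y xy]; have [xo ya] := winlr_eq xy.
by split; [rewrite xo|rewrite xy ya].
Qed.

(** The image under [rR] of a composite that ends in the left side ends at the
    first vertex of the right side, so it is an identity. *)
Lemma rR_trivial a b (t : term p a b) : inL b ->
  arr (term_map rR t) = arr (tid p (alpha Y)).
Proof.
move=> [x bx]; apply: (initial_end_term Yi).
by rewrite bx [LHS]wcase_inl /= cst0.
Qed.

Lemma rL_trivial a b (t : term p a b) : inR a ->
  arr (term_map rL t) = arr (tid p (omega X)).
Proof.
move=> [y ay]; apply: (terminal_end_term Xt).
by rewrite ay [LHS]wcase_inr /= cst0.
Qed.

Lemma rLK x y (u : term p x y) : arr (term_map rL (term_map L u)) = arr u.
Proof.
rewrite arr_map_comp (_ : scomp _ _ = sid X) ?arr_map_id//.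
by apply: sMap_eq => n z; exact: wretlK.
Qed.

Lemma rRK x y (u : term p x y) : arr (term_map rR (term_map R u)) = arr u.
Proof.
rewrite arr_map_comp (_ : scomp _ _ = sid Y) ?arr_map_id//.
by apply: sMap_eq => n z; exact: wretrK.
Qed.

Lemma fixL a b (t : term p a b) x y (u : term p x y) :
  arr t = arr (term_map L u) -> arr t = arr (term_map L (term_map rL t)).
Proof. by move=> tu; rewrite (arr_map L (arr_map rL tu)) (arr_map L (rLK u)). Qed.

Lemma fixR a b (t : term p a b) x y (u : term p x y) :
  arr t = arr (term_map R u) -> arr t = arr (term_map R (term_map rR t)).
Proof. by move=> tu; rewrite (arr_map R (arr_map rR tu)) (arr_map R (rRK u)). Qed.

(** The middle clause for a composite from left to right does not say that t
    is the composite of its two images, because the target of one image and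
    the source of the other are equal to the joint only propositionally; m
    stands for that joint.  The last clause says that a composite from right
    to left stays at the joint. *)
Definition factors a b (t : term p a b) :=
  [/\ inL a -> inL b -> arr t = arr (term_map L (term_map rL t)),
      inR a -> inR b -> arr t = arr (term_map R (term_map rR t)),
      inL a -> inR b -> exists m (h : term p m b) (g : term p a m),
        [/\ arr h = arr (term_map R (term_map rR t)),
            arr g = arr (term_map L (term_map rL t)) &
            arr t = arr (tcomp h g)]
    & inR a -> inL b -> inL a /\ inR b].

(** A composite that comes from the left side is its own left image, and its
    right image is an identity.  If moreover it starts in the right side, it
    starts at the joint and is an identity, which may be seen as coming from
    the right. *)
Lemma factorsL a b (t : term p a b) x y (u : term p x y) :
  arr t = arr (term_map L u) -> factors t.
Proof.
move=> tu; have ax := arr_src tu; have bx := arr_tgt tu.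
have tid_joint : inR a -> arr t = arr (term_map R (tid p (alpha Y))).
  move=> aR; have aL : inL a by exists x.
  have [ao _] := joint_inLR aL aR.
  have xo : x = omega X by apply: (@winl_inj X Y); rewrite -/L -ax ao.
  rewrite tu (arr_map L (terminal_end_term Xt u xo)).
  by apply: arr_tid; exact: wglue.
split.
- by move=> _ _; exact: fixL tu.
- by move=> aR _; exact: fixR (tid_joint aR).
- move=> aL bR; exists b, (tid p b), t; split.
  + rewrite (arr_map R (rR_trivial t _)); last by exists y.
    have [|_ ->] := @joint_inLR b _ bR; first by exists y.
    by [].
  + exact: fixL tu.
  + by rewrite (arr_idl _ (y := b)).
- move=> aR _; split; first by exists x.
  by rewrite (arr_tgt (tid_joint aR)); exists (alpha Y).
Qed.

Lemma factorsR a b (t : term p a b) x y (u : term p x y) :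
  arr t = arr (term_map R u) -> factors t.
Proof.
move=> tu; have ax := arr_src tu; have bx := arr_tgt tu.
have tid_joint : inL b -> arr t = arr (term_map L (tid p (omega X))).
  move=> bL; have bR : inR b by exists y.
  have [_ bo] := joint_inLR bL bR.
  have yo : y = alpha Y by apply: (@winr_inj X Y); rewrite -/R -bx bo.
  rewrite tu (arr_map R (initial_end_term Yi u yo)).
  by apply: arr_tid; rewrite -wglue.
split.
- by move=> _ bL; exact: fixL (tid_joint bL).
- by move=> _ _; exact: fixR tu.
- move=> aL bR; exists a, t, (tid p a); split.
  + exact: fixR tu.
  + rewrite (arr_map L (rL_trivial t _)); last by exists x.
    have [|-> _] := @joint_inLR a aL; first by exists x.
    by [].
  + by rewrite (arr_idr _ (y := a)).
- move=> _ bL; split; last by exists y.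
  by rewrite (arr_src (tid_joint bL)); exists (omega X).
Qed.

(** In a composite a -> b -> c the middle vertex may be taken on the same side
    as c if c is on the left, and on the same side as a if a is on the right:
    a composite from right to left stays at the joint.  So the factorizations
    of the two halves fit together. *)
Lemma term_factors a b (t : term p a b) : factors t.
Proof.
elim: t => {a b} [a|a b c h [hL hR hC hB] g [gL gR gC gB]|n s i j a b ea eb c].
- case: (wedge_cover a) => -[x ->].
    exact: (factorsL (u := tid p x)).
  exact: (factorsR (u := tid p x)).
- have b_inL : inL c -> inL b.
    by case: (wedge_cover b) => // bR cL; case: (hB bR cL).
  have b_inR : inR a -> inR b.
    by case: (wedge_cover b) => // bL aR; case: (gB aR bL).
  split.
  + by move=> aL /[dup] /b_inL bL cL; apply: arr_comp; [exact: hL|exact: gL].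
  + by move=> /[dup] /b_inR bR aR cR; apply: arr_comp; [exact: hR|exact: gR].
  + move=> aL cR; case: (wedge_cover b) => [bL|bR].
      have [m [h2 [h1 [e2 e1 e]]]] := hC bL cR.
      exists m, h2, (tcomp h1 g); split.
      * rewrite e2 /= (arr_idr _ (arr_map R (rR_trivial g bL))) //.
      * by apply: arr_comp => //; exact: gL.
      * by rewrite arr_assoc; exact: arr_comp.
    have [m [g2 [g1 [e2 e1 e]]]] := gC aL bR.
    exists m, (tcomp h g2), g1; split.
    * by apply: arr_comp => //; exact: hR.
    * rewrite e1 /= (arr_idl _ (arr_map L (rL_trivial h bR))) //.
    * by rewrite -arr_assoc; exact: arr_comp.
  + move=> aR cL; have bL := b_inL cL; have bR := b_inR aR.
    by split; [case: (gB aR bL)|case: (hB bR cL)].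
- case: (wedge_simplex s) => -[s' es].
    exact: (factorsL (arr_gen_map ea eb c es)).
  exact: (factorsR (arr_gen_map ea eb c es)).
Qed.

End WedgeFactor.

(** * Over a necklace, composites are determined by their flags *)

Definition flag_determined (X : sSet) :=
  forall p a b a' b' (t : @term X p a b) (t' : @term X p a' b'),
    a = a' -> b = b' -> term_flag t = term_flag t' -> arr t = arr t'.

(** The flags of the two retracts are the images of the flag, so the retracts
    are determined by it, and the factorization recovers the composite from
    the retracts. *)
Lemma wedge_flag_determined X Y : terminal_end X -> initial_end Y ->
  flag_determined X -> flag_determined Y -> flag_determined (wedge X Y).
Proof.
move=> Xt Yi Xd Yd p a b a' b' t t' aa bb tt'.
case: _ / aa in t' tt' *; case: _ / bb in t' tt' *.
have rE (Z : sSet) (r : sMap (wedge X Y) Z) :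
    term_flag (term_map r t) = term_flag (term_map r t').
  by apply/funext => k; rewrite !term_flag_map tt'.
have eL := arr_map (winl X Y) (Xd _ _ _ _ _ _ _ erefl erefl (rE _ (wretl X Y))).
have eR := arr_map (winr X Y) (Yd _ _ _ _ _ _ _ erefl erefl (rE _ (wretr X Y))).
have [tL tR tC tB] := term_factors Xt Yi t.
have [tL' tR' tC' _] := term_factors Xt Yi t'.
case: (wedge_cover a) (wedge_cover b) => [aL|aR] [bL|bR].
- by rewrite tL // tL'.
- have [m [h [g [hE gE ->]]]] := tC aL bR.
  have [m' [h' [g' [hE' gE' ->]]]] := tC' aL bR.
  by apply: arr_comp; rewrite ?hE ?hE' ?gE ?gE'.
- by have [aL _] := tB aR bL; rewrite tL // tL'.
- by rewrite tR // tR'.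
Qed.

(** The chosen form of a composite is a generator on the identity of [Delta
    n]: every generator is pushed there by [rel_gen_map], and [rel_gen_comp]
    merges two consecutive ones. *)
Lemma Delta_term p n a b (t : @term (Delta n) p a b) :
  exists i j (c : Phom i j p),
    arr t = arr (@tgen (Delta n) p n (sid _) i j _ _ erefl erefl c).
Proof.
elim: t => {a b} [a|a b d h [j [k [ch hE]]] g [i [l [cg gE]]]|m s i j a b ea eb c].
- exists (a ord0), (a ord0), (cst p (idm (a ord0 : CDelta n))).
  by rewrite arr_gen_id //; apply: arr_tid; exact: vtxE.
- have lj : l = j.
    by apply: vtx_inj; exact: etrans (esym (arr_tgt gE)) (arr_src hE).
  case: _ / lj in ch hE *.
  exists i, k, (Pcomp ch cg); rewrite (arr_comp hE gE).
  by apply/esym/arr_rel; exact: (@rel_gen_comp (Delta n) p n (sid _)).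
- pose f : dmap m n := s m (did m).
  by exists (f i), (f j); eexists; exact: arr_gen_Delta.
Qed.

Lemma bead_flag_determined n : flag_determined (bead n).
Proof.
move=> p a b a' b' t t' aa bb tt'.
have [i [j [c tE]]] := Delta_term t.
have [i' [j' [c' tE']]] := Delta_term t'.
have cc' := etrans (esym (term_flag_arr tE)) (etrans tt' (term_flag_arr tE')).
rewrite tE tE'; apply: arr_gen => // [||k].
- apply: vtx_inj.
  exact: etrans (esym (arr_src tE)) (etrans aa (arr_src tE')).
- apply: vtx_inj.
  exact: etrans (esym (arr_tgt tE)) (etrans bb (arr_tgt tE')).
- apply/funext => l.
  rewrite -(image_inj (A := c k) (a := l) (@vtx_inj n))
    -(image_inj (A := c' k) (a := l) (@vtx_inj n)).
  by have := congr1 (fun f : _ -> set (Delta n 0) => f k (vtx l)) cc'.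
Qed.

Lemma necklace_flag_determined (T : necklace) : flag_determined T.
Proof.
elim: T => [n|U ? V ?]; first exact: bead_flag_determined.
by apply: wedge_flag_determined => //;
  [exact: necklace_terminal|exact: necklace_initial].
Qed.

(** * From flagged necklaces to composites *)

Section NecklaceTerm.
Variable p : nat.

Definition fchain (X : Type) := chain (fun A B : set X => A `<=` B) p.

Definition fchain_pre (X Y : Type) (f : X -> Y) (F : fchain Y) : fchain X :=
  @Chain _ (fun A B : set X => A `<=` B) p (fun k => f @^-1` F k)
    (fun i j ij => preimage_subset (chain_mono F ij)).

(** Adding the two ends makes [neck_term] defined for arbitrary chains, so
    that its recursion need not carry the condition on the joints.  On a flag
    that contains the joints nothing is added. *)
Program Definition end_chain n (F : fchain (Delta n 0)) :
    Phom (ord0 : 'I_n.+1) (ord_max : 'I_n.+1) p :=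
  @Chain _ _ p (fun k => @mkPset n ord0 ord_max
    [set l | [\/ F k (vtx l), l = ord0 | l = ord_max]] _ _ _) _.
Next Obligation. by move=> *; constructor 2. Qed.
Next Obligation. by move=> *; constructor 3. Qed.
Next Obligation. by move=> n F k l _ /=; rewrite leq_ord. Qed.
Next Obligation.
move=> n F i j ij l /= [Fl|l0|l1]; last 2 first.
- by constructor 2.
- by constructor 3.
by constructor 1; exact: (chain_mono F ij).
Qed.

Variable S : sSet.

(** The endpoints a and b are variables with equations because the two sides
    of a wedge meet at a vertex of [S] that has two expressions, related by
    [wglue]. *)
Fixpoint neck_term (T : necklace) : forall (s : sMap T S) a b,
    s 0 (alpha T) = a -> s 0 (omega T) = b -> fchain (T 0) -> term p a b :=
  match T with
  | bead n => fun s a b ea eb F =>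
      @tgen S p n s ord0 ord_max a b ea eb (end_chain F)
  | join U V => fun s a b ea eb F =>
      tcomp
        (@neck_term V (scomp s (winr U V)) _ _
           (esym (f_equal (s 0) (wglue U V))) eb (fchain_pre (winr U V 0) F))
        (@neck_term U (scomp s (winl U V)) _ _
           ea erefl (fchain_pre (winl U V 0) F))
  end.

Lemma neck_term_arr (T : necklace) (s s' : sMap T S) a b a' b'
    (ea : s 0 (alpha T) = a) (eb : s 0 (omega T) = b)
    (ea' : s' 0 (alpha T) = a') (eb' : s' 0 (omega T) = b')
    (F F' : fchain (T 0)) :
  s = s' -> (forall k, F k = F' k) ->
  arr (neck_term ea eb F) = arr (neck_term ea' eb' F').
Proof.
move=> ss; case: _ / ss in ea' eb' *; move/chain_eq => FF'; rewrite -{}FF'.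
case: _ / ea; case: _ / ea'; case: _ / eb; case: _ / eb'.
by [].
Qed.

Lemma term_flag_neck_term (T : necklace) (s : sMap T S) a b
    (ea : s 0 (alpha T) = a) (eb : s 0 (omega T) = b) (F : fchain (T 0)) k :
  joints T `<=` F k -> term_flag (neck_term ea eb F) k = s 0 @` F k.
Proof.
elim: T s a b ea eb F => [n|U IHU V IHV] s a b ea eb F jF /=.
  apply/seteqP; split => [_ [l lF <-]|_ [x Fx <-]] /=.
    exists (vtx l) => //; case: lF => // ->; apply: jF; [by left|by right].
  by exists (x ord0); rewrite /= -?vtxE //; constructor 1.
rewrite IHU; last by move=> x jx; apply: jF; left; exists x.
rewrite IHV; last by move=> y jy; apply: jF; right; exists y.
apply/seteqP; split => [x [[y Fy <-]|[y Fy <-]]|_ [x Fx <-]].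
- by exists (winr U V 0 y).
- by exists (winl U V 0 y).
- case: (wedge_cover x) => -[y xy]; rewrite xy in Fx *.
    by right; exists y.
  by left; exists y.
Qed.

Lemma joints_ends (T : necklace) : joints T (alpha T) /\ joints T (omega T).
Proof.
elim: T => [n|U [aU oU] V [aV oV]] /=; first by split; [left|right].
by split; [left; exists (alpha U)|right; exists (omega V)].
Qed.

End NecklaceTerm.

Lemma neck_term_act p q (h : dmap p q) S (T : necklace) (s : sMap T S) a b
    (ea : s 0 (alpha T) = a) (eb : s 0 (omega T) = b) (F : fchain q (T 0)) :
  term_act h (neck_term ea eb F) = neck_term ea eb (chain_act h F).
Proof.
elim: T s a b ea eb F => [n|U IHU V IHV] s a b ea eb F /=.
  by congr tgen; exact: Phom_eq.
by rewrite IHU IHV; congr (tcomp (neck_term _ _ _) (neck_term _ _ _));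
  exact: chain_eq.
Qed.

Lemma neck_term_map p S S' (f : sMap S S') (T : necklace) (s : sMap T S) a b a' b'
    (ea : s 0 (alpha T) = a) (eb : s 0 (omega T) = b)
    (ea' : f 0 (s 0 (alpha T)) = a') (eb' : f 0 (s 0 (omega T)) = b')
    (F : fchain p (T 0)) :
  arr (term_map f (neck_term ea eb F)) =
  arr (@neck_term p S' T (scomp f s) _ _ ea' eb' F).
Proof.
elim: T s a b a' b' ea eb ea' eb' F =>
  [n|U IHU V IHV] s a b a' b' ea eb ea' eb' F /=.
  exact: arr_gen.
apply: arr_comp.
  rewrite (IHV _ _ _ _ _ _ _ erefl erefl).
  by apply: neck_term_arr => //; exact: sMap_eq.
rewrite (IHU _ _ _ _ _ _ _ erefl erefl).
by apply: neck_term_arr => //; exact: sMap_eq.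
Qed.

Section FlaggedTerm.
Variable S : sSet.
Implicit Types a b c : S 0.

Definition flag_chain a b p (t : flagged a b p) : fchain p (neck t 0) :=
  Chain (@flag_mono _ _ _ _ t).

Definition flagged_term a b p (t : flagged a b p) : term p a b :=
  neck_term (nmap_src t) (nmap_tgt t) (flag_chain t).

Lemma joints_flag a b p (t : flagged a b p) k : joints (neck t) `<=` flag t k.
Proof. exact: subset_trans (@flag_joints _ _ _ _ t) (flag_mono _). Qed.

(** Both terms are images under [nmap u] of terms over the necklace U of [u]:
    the one of f itself, as a flagged necklace over U, and the one of the
    identity of U.  By the condition on the flags these two have the same
    flag, so they are equal. *)
Lemma flagged_term_map a b p (t u : flagged a b p) : flag_map t u ->
  arr (flagged_term t) = arr (flagged_term u).
Proof.
move=> [f [fa fo fS fu]].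
pose tU := @neck_term p (neck u) (neck t) f _ _ fa fo (flag_chain t).
pose uU := @neck_term p (neck u) (neck u) (sid _) _ _ erefl erefl (flag_chain u).
have tuU : arr tU = arr uU.
  apply: (@necklace_flag_determined (neck u)) => //; apply/funext => k.
  rewrite /tU /uU !term_flag_neck_term ?image_id; first by rewrite /= fu.
  - exact: joints_flag.
  - exact: joints_flag.
have sa : nmap u 0 (f 0 (alpha (neck t))) = a by rewrite fa nmap_src.
have so : nmap u 0 (f 0 (omega (neck t))) = b by rewrite fo nmap_tgt.
have := arr_map (nmap u) tuU; rewrite /tU /uU.
rewrite (neck_term_map fa fo sa so).
rewrite (@neck_term_map p _ _ (nmap u) (neck u) (sid _) _ _ _ _ erefl erefl
  (nmap_src u) (nmap_tgt u)) => e.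
transitivity
  (arr (@neck_term p S (neck t) (scomp (nmap u) f) _ _ sa so (flag_chain t))).
  by apply: neck_term_arr.
by rewrite e; apply: neck_term_arr => //; exact: sMap_eq.
Qed.

Definition neck_rcls a b p (t : flagged a b p) : rsimp a b p :=
  rcls (flagged_term t).

Program Definition neck_to_rigid a b : sMap (neck_hom a b) (@hom (rigid S) a b) :=
  @SMap (neck_hom a b) (rhom a b) (fun p => quot_lift (@neck_rcls a b p)) _.
Next Obligation.
move=> a b m n f; elim/quot_ind => t.
have E k (v : flagged a b k) :
    quot_lift (@neck_rcls a b k) (neck_cls v) = neck_rcls v.
  by apply: quot_liftE => ? ? ?; apply: arr_rcls; exact: flagged_term_map.
rewrite /= (neck_actE f t) !E /neck_rcls ractE /flagged_term neck_term_act.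
by congr (rcls (neck_term _ _ _)); exact: chain_eq.
Qed.

Lemma neck_to_rigidE a b p (t : flagged a b p) :
  neck_to_rigid a b p (neck_cls t) = rcls (flagged_term t).
Proof.
apply: (quot_liftE (f := @neck_rcls a b p)) => ? ? ?; apply: arr_rcls.
exact: flagged_term_map.
Qed.

(** Restricting the flag of the wedge to one side gives back the flag of that
    side: the other side contributes at most the joint, which the flag already
    contains. *)
Lemma flagged_term_comp a b c p (t : flagged b c p) (u : flagged a b p) :
  arr (flagged_term (flagged_comp t u)) =
  arr (tcomp (flagged_term t) (flagged_term u)).
Proof.
have [aT _] := joints_ends (neck t); have [_ oU] := joints_ends (neck u).
apply: arr_comp; apply: neck_term_arr => [|k].
- by apply: sMap_eq => n x; exact: wcase_inr.
- apply/seteqP; split => [y [[x Fx /winlr_eq[_ ->]]|[y' Fy /winr_inj <-]]|y Fy] //.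
    exact: joints_flag aT.
  by right; exists y.
- by apply: sMap_eq => n x; exact: wcase_inl.
- apply/seteqP; split =>
    [x [[x' Fx /winl_inj <-]|[y Fy /esym/winlr_eq[-> _]]]|x Fx] //.
    exact: joints_flag oU.
  by left; exists x.
Qed.

End FlaggedTerm.

(** * Intervals of vertices of a simplex *)

Section Interval.
Variables (n : nat) (i j : 'I_n.+1).

(** The inclusion of the interval from i to j as a face.  When j < i truncated
    subtraction makes it the inclusion of the vertex i, so it is defined
    without hypothesis. *)
Program Definition itv_map : dmap (j - i) n :=
  @DMap (j - i) n (fun l => @Ordinal n.+1 (i + l) _) _.
Next Obligation.
by move=> l; have := ltn_ord l; have := ltn_ord i; have := ltn_ord j; lia.
Qed.
Next Obligation. by move=> l l' /=; rewrite leq_add2l. Qed.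

Lemma itv_map0 : itv_map ord0 = i.
Proof. by apply: val_inj; rewrite /= addn0. Qed.

Lemma itv_map_max : i <= j -> itv_map ord_max = j.
Proof. by move=> ij; apply: val_inj; rewrite /= subnKC. Qed.

Lemma itv_map_inj : injective itv_map.
Proof. by move=> l l' /(congr1 val) /= /addnI /val_inj. Qed.

Lemma itv_map_itv l : i <= j -> i <= itv_map l <= j.
Proof. by move=> ij /=; have := ltn_ord l; lia. Qed.

(** The maps between intervals in [itv_flag_map] and [flagged_itv_comp] are
    such lifts; their values on the ends and on the flags are then read off
    after composition with the injective map [itv_map]. *)
Lemma itv_map_lift q (f : dmap q n) : (forall l, i <= f l <= j) ->
  exists g : dmap q (j - i), dcomp itv_map g = f.
Proof.
move=> fij; have gP l : f l - i < (j - i).+1 by have := fij l; lia.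
have g_mono (l l' : 'I_q.+1) : l <= l' -> Ordinal (gP l) <= Ordinal (gP l').
  by move=> /(dmap_mono f) ll' /=; exact: leq_sub2r.
exists (DMap g_mono); apply: dmap_eq => l; apply: val_inj => /=.
by have := fij l; lia.
Qed.

Lemma itv_vtx_lift (l : 'I_n.+1) : i <= l <= j ->
  exists x : Delta (j - i) 0, itv_map ((x : dmap _ _) ord0) = l.
Proof.
move=> lij; have [|g gl] := @itv_map_lift 0 (dconst 0 l); first by [].
by exists g; exact: (congr1 (fun f : dmap 0 n => f ord0) gl).
Qed.

End Interval.

(** * From composites to flagged necklaces *)

Section TermFlagged.
Variables (S : sSet) (p : nat).
Implicit Types a b c : S 0.

Lemma yoneda0 a (x : Delta 0 0) : yoneda a 0 x = a.
Proof.
rewrite /= -[RHS]act_id; congr act; apply: dmap_eq => l /=.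
by rewrite [LHS]ord1 [RHS]ord1.
Qed.

Definition flagged_id a : flagged a a p :=
  @Flagged S a a p (bead 0) (yoneda a) (yoneda0 _ _) (yoneda0 _ _)
    (fun _ => setT) (fun _ _ _ => @subsetT _ _) (@subsetT _ _).

(** A bead must start at a and end at b, so the simplex is cut down to the
    interval from i to j before it is used as a necklace. *)
Program Definition flagged_itv n (s : sMap (Delta n) S) (i j : 'I_n.+1) a b
    (ea : s 0 (vtx i) = a) (eb : s 0 (vtx j) = b) (c : Phom i j p) :
    flagged a b p :=
  @Flagged S a b p (bead (j - i)) (scomp s (Delta_map (itv_map i j))) _ _
    (fun k => [set x : Delta (j - i) 0 |
      pset (c k) (itv_map i j ((x : dmap _ _) ord0))])
    _ _.
Next Obligation.
move=> n s i j a b <- _ c /=; congr (s 0); apply: dmap_eq => l /=.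
exact: itv_map0.
Qed.
Next Obligation.
move=> n s i j a b _ <- c /=; congr (s 0); apply: dmap_eq => l /=.
exact: itv_map_max (Pset_le (c ord0)).
Qed.
Next Obligation.
by move=> n s i j a b _ _ c k l kl x /=; exact: (chain_mono c kl).
Qed.
Next Obligation.
move=> n s i j a b _ _ c _ [->|->].
  by change (pset (c ord0) (itv_map i j ord0)); rewrite itv_map0; exact: pset_src.
change (pset (c ord0) (itv_map i j ord_max)).
by rewrite itv_map_max ?(Pset_le (c ord0)) //; exact: pset_tgt.
Qed.

Fixpoint term_flagged a b (t : term p a b) : flagged a b p :=
  match t with
  | tid a => flagged_id a
  | tcomp _ _ _ h g => flagged_comp (term_flagged h) (term_flagged g)
  | @tgen _ _ n s i j _ _ ea eb c => flagged_itv ea eb c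
  end.

Section WedgeMap.
Variables (X X' Y Y' : bpSet) (f : sMap X X') (g : sMap Y Y').
Hypotheses (fo : f 0 (omega X) = omega X') (ga : g 0 (alpha Y) = alpha Y').

Lemma wmap_glue :
  scomp (winl X' Y') f 0 (omega X) = scomp (winr X' Y') g 0 (alpha Y).
Proof. by rewrite /= fo ga; exact: (wglue X' Y'). Qed.

Definition wmap : sMap (wedge X Y) (wedge X' Y') := wcase wmap_glue.

Lemma wmap_inl m x : wmap m (winl X Y m x) = winl X' Y' m (f m x).
Proof. exact: wcase_inl. Qed.

Lemma wmap_inr m y : wmap m (winr X Y m y) = winr X' Y' m (g m y).
Proof. exact: wcase_inr. Qed.

End WedgeMap.

Lemma nmap_comp_inl a b c (t : flagged b c p) (u : flagged a b p) m x :
  nmap_comp t u m (winl (neck u) (neck t) m x) = nmap u m x.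
Proof. exact: wcase_inl. Qed.

Lemma nmap_comp_inr a b c (t : flagged b c p) (u : flagged a b p) m y :
  nmap_comp t u m (winr (neck u) (neck t) m y) = nmap t m y.
Proof. exact: wcase_inr. Qed.

Lemma flagged_comp_map a b c (t t' : flagged b c p) (u u' : flagged a b p) :
  flag_map t t' -> flag_map u u' ->
  flag_map (flagged_comp t u) (flagged_comp t' u').
Proof.
move=> [f [fa fo fS fF]] [g [ga go gS gF]]; exists (wmap go fa); split.
- by rewrite [LHS]wcase_inl /= ga.
- by rewrite [LHS]wcase_inr /= fo.
- apply: wcase_uniq.
    apply: sMap_eq => n x.
    change (nmap_comp t' u' n (wmap go fa n (winl _ _ n x)) = nmap u n x).
    by rewrite wmap_inl nmap_comp_inl -gS.
  apply: sMap_eq => n x.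
  change (nmap_comp t' u' n (wmap go fa n (winr _ _ n x)) = nmap t n x).
  by rewrite wmap_inr nmap_comp_inr -fS.
- move=> k; rewrite /= /flag_comp image_setU !image_comp fF gF !image_comp.
  congr (_ `|` _); apply: eq_imagel => x _; apply/esym.
    exact: wmap_inl.
  exact: wmap_inr.
Qed.

Lemma flag_map_refl a b (t : flagged a b p) : flag_map t t.
Proof.
by exists (sid _); split => // [|k]; [exact: sMap_eq|rewrite /= image_id].
Qed.

(** The equivalence closure is not componentwise, so one factor is moved at a
    time, along its chain of elementary relations. *)
Lemma flagged_comp_cls a b c (t t' : flagged b c p) (u u' : flagged a b p) :
  neck_cls t = neck_cls t' -> neck_cls u = neck_cls u' ->
  neck_cls (flagged_comp t u) = neck_cls (flagged_comp t' u').
Proof.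
move=> /cls_eqP tt' /cls_eqP uu'; transitivity (neck_cls (flagged_comp t' u)).
  elim: tt' => {t t'} [t t' tt'|//|t t' _ -> //|t v t' _ -> _ -> //].
  by apply: cls_eq; exact: flagged_comp_map tt' (flag_map_refl u).
elim: uu' => {u u'} [u u' uu'|//|u u' _ -> //|u v u' _ -> _ -> //].
by apply: cls_eq; exact: flagged_comp_map (flag_map_refl t') uu'.
Qed.

(** Associativity of the wedge, as a map in one direction: this is enough for
    the two flagged necklaces to be equivalent. *)
Lemma flagged_compA a b c d (h : flagged c d p) (g : flagged b c p)
    (f : flagged a b p) :
  flag_map (flagged_comp h (flagged_comp g f))
    (flagged_comp (flagged_comp h g) f).
Proof.
set F := neck f; set G := neck g; set H := neck h.
pose gr : sMap G (wedge F (wedge G H)) := scomp (winr F (wedge G H)) (winl G H).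
pose hr : sMap H (wedge F (wedge G H)) := scomp (winr F (wedge G H)) (winr G H).
have fg : winl F (wedge G H) 0 (omega F) = gr 0 (alpha G).
  exact: (wglue F (wedge G H)).
have e : wcase fg 0 (omega (wedge F G)) = hr 0 (alpha H).
  by rewrite [LHS]wcase_inr /=; congr (winr F (wedge G H) 0); exact: wglue.
exists (wcase e); split.
- by rewrite [LHS]wcase_inl [LHS]wcase_inl.
- by rewrite [LHS]wcase_inr.
- apply: sMap_eq => n z; case: (wedge_cover z) => -[w ->] {z}; last first.
    change (nmap_comp (flagged_comp h g) f n (wcase e n (winr _ _ n w)) =
      nmap_comp h (flagged_comp g f) n (winr _ _ n w)).
    by rewrite wcase_inr !nmap_comp_inr.
  change (nmap_comp (flagged_comp h g) f n (wcase e n (winl _ _ n w)) =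
      nmap_comp h (flagged_comp g f) n (winl _ _ n w)).
  rewrite wcase_inl nmap_comp_inl; case: (wedge_cover w) => -[x ->] {w}.
    by rewrite wcase_inl [LHS]nmap_comp_inl [RHS]nmap_comp_inl.
  by rewrite wcase_inr [LHS]nmap_comp_inr [LHS]nmap_comp_inl [RHS]nmap_comp_inr.
- move=> k; rewrite /= /flag_comp /= /flag_comp !image_setU !image_comp -setUA.
  congr (_ `|` (_ `|` _)); apply: eq_imagel => x _; apply/esym.
  + exact: etrans (wcase_inl e _) (wcase_inl fg x).
  + exact: etrans (wcase_inl e _) (wcase_inr fg x).
  + exact: (wcase_inr e x).
Qed.

End TermFlagged.

Section TermFlaggedRel.
Variables (S : sSet) (p : nat).
Implicit Types a b c : S 0.

Lemma Delta0_eq m (x y : Delta 0 m) : x = y.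
Proof. by apply: dmap_eq => i; rewrite [LHS]ord1 [RHS]ord1. Qed.

(** The bead of dimension 0 is collapsed to the joint, which is already in the
    flag. *)
Lemma flagged_comp1m a b (f : flagged a b p) :
  flag_map (flagged_comp (flagged_id p b) f) f.
Proof.
have e : sid (neck f) 0 (omega (neck f)) =
    sconst (Delta 0) (omega (neck f)) 0 (alpha (simplex 0)).
  by rewrite /= cst0.
pose q : sMap (wedge (neck f) (simplex 0)) (neck f) :=
  @wcase (neck f) (simplex 0) (neck f) (sid _) (sconst (Delta 0) _) e.
have ql m x : q m (winl _ _ m x) = x by exact: wcase_inl.
have qr m y : q m (winr _ _ m y) = cst m (omega (neck f)) by exact: wcase_inr.
exists q; split.
- exact: ql.
- by rewrite [LHS]qr cst0.
- apply: sMap_eq => n z; case: (wedge_cover z) => -[x ->] {z}.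
    change (nmap f n (q n (winl _ _ n x)) =
      nmap_comp (flagged_id p b) f n (winl _ _ n x)).
    by rewrite nmap_comp_inl ql.
  change (nmap f n (q n (winr _ _ n x)) =
    nmap_comp (flagged_id p b) f n (winr _ _ n x)).
  rewrite nmap_comp_inr qr /= smap_cst nmap_tgt /cst.
  by congr act; exact: Delta0_eq.
- move=> k; rewrite /= /flag_comp image_setU !image_comp.
  apply/seteqP; split => [x fx|x [[y fy <-]|[y _ <-]]].
  + by left; exists x => //; exact: ql.
  + by rewrite [X in flag f k X]ql.
  + rewrite [X in flag f k X]qr cst0.
    by apply: joints_flag; have [] := joints_ends (neck f).
Qed.

Lemma flagged_compm1 a b (f : flagged a b p) :
  flag_map (flagged_comp f (flagged_id p a)) f.
Proof.
have e : sconst (Delta 0) (alpha (neck f)) 0 (omega (simplex 0)) =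
    sid (neck f) 0 (alpha (neck f)).
  by rewrite /= cst0.
pose q : sMap (wedge (simplex 0) (neck f)) (neck f) :=
  @wcase (simplex 0) (neck f) (neck f) (sconst (Delta 0) _) (sid _) e.
have ql m x : q m (winl _ _ m x) = cst m (alpha (neck f)) by exact: wcase_inl.
have qr m y : q m (winr _ _ m y) = y by exact: wcase_inr.
exists q; split.
- by rewrite [LHS]ql cst0.
- exact: qr.
- apply: sMap_eq => n z; case: (wedge_cover z) => -[x ->] {z}; last first.
    change (nmap f n (q n (winr _ _ n x)) =
      nmap_comp f (flagged_id p a) n (winr _ _ n x)).
    by rewrite nmap_comp_inr qr.
  change (nmap f n (q n (winl _ _ n x)) =
    nmap_comp f (flagged_id p a) n (winl _ _ n x)).
  rewrite nmap_comp_inl ql /= smap_cst nmap_src /cst.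
  by congr act; exact: Delta0_eq.
- move=> k; rewrite /= /flag_comp image_setU !image_comp.
  apply/seteqP; split => [x fx|x [[y _ <-]|[y fy <-]]].
  + by right; exists x => //; exact: qr.
  + rewrite [X in flag f k X]ql cst0.
    by apply: joints_flag; have [] := joints_ends (neck f).
  + by rewrite [X in flag f k X]qr.
Qed.

Lemma flagged_itv_id n (s : sMap (Delta n) S) i a
    (e e' : s 0 (vtx i) = a) :
  flag_map (flagged_itv e e' (cst p (idm (i : CDelta n)))) (flagged_id p a).
Proof.
exists (sconst _ (vtx ord0)); split.
- exact: Delta0_eq.
- exact: Delta0_eq.
- apply: sMap_eq => m x /=.
  rewrite -[a in act _ a]e -smap_nat; congr (s m); apply: dmap_eq => l /=.
  by apply: val_inj => /=; have := ltn_ord ((x : dmap _ _) l); lia.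
- move=> k; apply/seteqP; split => [y _|//].
  exists (vtx ord0); last exact: Delta0_eq.
  by change (itv_map i i ord0 = i); exact: itv_map0.
Qed.

(** The map of beads is the lift of f, restricted to the interval from i to j,
    through the interval from i' to j'. *)
Lemma itv_flag_map m n (f : dmap m n) (i j : 'I_m.+1) (i' j' : 'I_n.+1)
    (s : sMap (Delta m) S) (s' : sMap (Delta n) S) a b
    (ea : s 0 (vtx i) = a) (eb : s 0 (vtx j) = b)
    (ea' : s' 0 (vtx i') = a) (eb' : s' 0 (vtx j') = b)
    (c : Phom i j p) (c' : Phom i' j' p) :
  s = scomp s' (Delta_map f) -> f i = i' -> f j = j' ->
  (forall k, f @` c k = c' k) ->
  flag_map (flagged_itv ea eb c) (flagged_itv ea' eb' c').
Proof.
move=> es fi fj fc.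
have ij := Pset_le (c ord0); have ij' := Pset_le (c' ord0).
have [|g gE] := @itv_map_lift n i' j' _ (dcomp f (itv_map i j)).
  move=> l; have /andP[il lj] := itv_map_itv l ij.
  by rewrite -fi -fj /= !dmap_mono.
have gf l : itv_map i' j' (g l) = f (itv_map i j l).
  exact: (congr1 (fun h : dmap _ n => h l) gE).
exists (Delta_map g); split.
- apply: dmap_eq => l; apply: (@itv_map_inj _ i' j').
  change (itv_map i' j' (g ord0) = itv_map i' j' ord0).
  by rewrite gf !itv_map0.
- apply: dmap_eq => l; apply: (@itv_map_inj _ i' j').
  change (itv_map i' j' (g ord_max) = itv_map i' j' ord_max).
  by rewrite gf !itv_map_max.
- apply: sMap_eq => q x; rewrite /= es /=; congr (s' q).
  by apply: dmap_eq => l /=; exact: gf.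
- move=> k; apply/seteqP; split => [x cx|_ [x cx <-]].
    have : (f @` c k) (itv_map i' j' ((x : dmap _ _) ord0)) by rewrite fc.
    case=> l cl lx.
    have [y yl] := itv_vtx_lift (pset_itv cl).
    exists y.
      by change (pset (c k) (itv_map i j ((y : dmap _ _) ord0))); rewrite yl.
    apply: dmap_eq => o; rewrite [o]ord1; apply: (@itv_map_inj _ i' j').
    by rewrite -lx -yl; exact: gf.
  change (pset (c' k) (itv_map i' j' (g ((x : dmap _ _) ord0)))).
  by rewrite gf -fc; exists (itv_map i j ((x : dmap _ _) ord0)).
Qed.

(** The intervals from i to j and from j to k, glued at j, map to the interval
    from i to k. *)
Lemma flagged_itv_comp n (s : sMap (Delta n) S) i j k a b c
    (ea : s 0 (vtx i) = a) (eb : s 0 (vtx j) = b) (ec : s 0 (vtx k) = c)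
    (h : Phom j k p) (g : Phom i j p) :
  flag_map (flagged_comp (flagged_itv eb ec h) (flagged_itv ea eb g))
    (flagged_itv ea ec (Pcomp h g)).
Proof.
have ij := Pset_le (g ord0); have jk := Pset_le (h ord0).
have ik := leq_trans ij jk.
have [|l lE] := @itv_map_lift n i k _ (itv_map i j).
  move=> x; have /andP[-> xj] := itv_map_itv x ij.
  exact: leq_trans xj jk.
have [|r rE] := @itv_map_lift n i k _ (itv_map j k).
  move=> x; have /andP[jx ->] := itv_map_itv x jk.
  by rewrite andbT; exact: leq_trans ij jx.
have lf x : itv_map i k (l x) = itv_map i j x.
  exact: (congr1 (fun h : dmap _ n => h x) lE).
have rf x : itv_map i k (r x) = itv_map j k x.
  exact: (congr1 (fun h : dmap _ n => h x) rE).
have lr : Delta_map l 0 (omega (simplex (j - i))) =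
    Delta_map r 0 (alpha (simplex (k - j))).
  apply: dmap_eq => o; apply: (@itv_map_inj _ i k).
  change (itv_map i k (l ord_max) = itv_map i k (r ord0)).
  by rewrite lf rf itv_map_max // itv_map0.
pose q : sMap (wedge (simplex (j - i)) (simplex (k - j))) (simplex (k - i)) :=
  @wcase (simplex _) (simplex _) (simplex _) (Delta_map l) (Delta_map r) lr.
have ql m x : q m (winl _ _ m x) = Delta_map l m x by exact: wcase_inl.
have qr m x : q m (winr _ _ m x) = Delta_map r m x by exact: wcase_inr.
exists q; split.
- rewrite [LHS]ql; apply: dmap_eq => o; apply: (@itv_map_inj _ i k).
  change (itv_map i k (l ord0) = itv_map i k ord0).
  by rewrite lf !itv_map0.
- rewrite [LHS]qr; apply: dmap_eq => o; apply: (@itv_map_inj _ i k).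
  change (itv_map i k (r ord_max) = itv_map i k ord_max).
  by rewrite rf !itv_map_max.
- apply: sMap_eq => m z; case: (wedge_cover z) => -[x ->] {z}.
    change (s m (dcomp (itv_map i k) (q m (winl _ _ m x))) =
      nmap_comp (flagged_itv eb ec h) (flagged_itv ea eb g) m (winl _ _ m x)).
    rewrite nmap_comp_inl ql; congr (s m).
    by apply: dmap_eq => o; exact: lf.
  change (s m (dcomp (itv_map i k) (q m (winr _ _ m x))) =
    nmap_comp (flagged_itv eb ec h) (flagged_itv ea eb g) m (winr _ _ m x)).
  rewrite nmap_comp_inr qr; congr (s m).
  by apply: dmap_eq => o; exact: rf.
- move=> t.
  have qF :
      q 0 @` flag (flagged_comp (flagged_itv eb ec h) (flagged_itv ea eb g)) t =
      Delta_map l 0 @` flag (flagged_itv ea eb g) t `|`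
      Delta_map r 0 @` flag (flagged_itv eb ec h) t.
    rewrite /= /flag_comp image_setU !image_comp.
    congr (_ `|` _); apply: eq_imagel => x _; first exact: ql.
    exact: qr.
  rewrite qF; apply/seteqP; split => [x [hx|gx]|_ [[x gx <-]|[x hx <-]]].
  + right; have [y yx] := itv_vtx_lift (pset_itv hx).
    exists y.
      by change (pset (h t) (itv_map j k ((y : dmap _ _) ord0))); rewrite yx.
    apply: dmap_eq => o; rewrite [o]ord1; apply: (@itv_map_inj _ i k).
    by rewrite -yx; exact: rf.
  + left; have [y yx] := itv_vtx_lift (pset_itv gx).
    exists y.
      by change (pset (g t) (itv_map i j ((y : dmap _ _) ord0))); rewrite yx.
    apply: dmap_eq => o; rewrite [o]ord1; apply: (@itv_map_inj _ i k).
    by rewrite -yx; exact: lf.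
  + right; change (pset (g t) (itv_map i k (l ((x : dmap _ _) ord0)))).
    by rewrite lf.
  + left; change (pset (h t) (itv_map i k (r ((x : dmap _ _) ord0)))).
    by rewrite rf.
Qed.

Lemma term_flagged_rel a b (t u : term p a b) : term_rel t u ->
  neck_cls (term_flagged t) = neck_cls (term_flagged u).
Proof.
elim=> {a b t u} /=.
- by move=> *; exact: flagged_comp_cls.
- by move=> *; exact: flagged_comp_cls.
- by move=> *; apply: cls_eq; exact: flagged_compA.
- by move=> *; apply: cls_eq; exact: flagged_comp1m.
- by move=> *; apply: cls_eq; exact: flagged_compm1.
- by move=> *; apply: cls_eq; exact: flagged_itv_id.
- by move=> *; apply/esym/cls_eq; exact: flagged_itv_comp.
- by move=> m n f *; apply: cls_eq; exact: (itv_flag_map (f := f)).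
Qed.

(** For a generator, pushing the chain on the interval forward along its
    inclusion gives back the chain that was restricted. *)
Lemma flagged_term_flagged a b (t : term p a b) :
  arr (flagged_term (term_flagged t)) = arr t.
Proof.
elim: t => {a b} /= [a|a b c h IHh g IHg|n s i j a b ea eb c].
- by apply: (arr_gen_id (n := 0)); exact: val_inj.
- by rewrite flagged_term_comp; exact: arr_comp.
- have ij := Pset_le (c ord0).
  apply: (arr_push (f := itv_map i j)) => //; first exact: itv_map0.
    exact: itv_map_max.
  move=> k; apply/seteqP; split => [_ [l [cl|->|->] <-] //|l cl].
  + by rewrite itv_map0; exact: pset_src.
  + by rewrite itv_map_max //; exact: pset_tgt.
  + have [y yl] := itv_vtx_lift (pset_itv cl).
    exists ((y : dmap _ _) ord0) => //; constructor 1.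
    by change (pset (c k) (itv_map i j ((y : dmap _ _) ord0))); rewrite yl.
Qed.

Definition mk_flagged (T : necklace) (s : sMap T S) a b
    (ea : s 0 (alpha T) = a) (eb : s 0 (omega T) = b) (F : fchain p (T 0))
    (jF : joints T `<=` F ord0) : flagged a b p :=
  @Flagged S a b p T s ea eb F (chain_mono F) jF.

(** On a bead the interval is the whole simplex; on a wedge the flag is the
    union of its restrictions to both sides. *)
Lemma term_flagged_neck_term (T : necklace) (s : sMap T S) a b
    (ea : s 0 (alpha T) = a) (eb : s 0 (omega T) = b) (F : fchain p (T 0))
    (jF : joints T `<=` F ord0) :
  neck_cls (term_flagged (neck_term ea eb F)) = neck_cls (mk_flagged ea eb jF).
Proof.
elim: T s a b ea eb F jF => [n|U IHU V IHV] s a b ea eb F jF.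
  apply: cls_eq.
  have jFk k x : joints (bead n) x -> F k x.
    by move=> /jF; exact: (chain_mono F).
  exists (Delta_map (itv_map (ord0 : 'I_n.+1) ord_max)); split => //.
  - by apply: dmap_eq => o; exact: itv_map0.
  - by apply: dmap_eq => o; exact: itv_map_max.
  - move=> k; apply/seteqP; split => [x Fx|_ [x xF <-]].
      have [|y yx] := @itv_vtx_lift n ord0 ord_max ((x : dmap _ _) ord0).
        exact: leq_ord.
      exists y; last by apply: dmap_eq => o; rewrite [o]ord1.
      by constructor 1; rewrite yx -vtxE.
    change (F k (dcomp (itv_map ord0 ord_max) x)).
    rewrite (vtxE (dcomp (itv_map ord0 ord_max) x)).
    case: xF => [//|e|e].
      change (F k (vtx (itv_map ord0 ord_max ((x : dmap _ _) ord0)))).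
      by rewrite e; apply: jFk; left.
    change (F k (vtx (itv_map ord0 ord_max ((x : dmap _ _) ord0)))).
    by rewrite e; apply: jFk; right.
have jU : joints U `<=` fchain_pre (winl U V 0) F ord0.
  by move=> x jx; apply: jF; left; exists x.
have jV : joints V `<=` fchain_pre (winr U V 0) F ord0.
  by move=> x jx; apply: jF; right; exists x.
apply: etrans (flagged_comp_cls (IHV _ _ _ _ _ _ jV) (IHU _ _ _ _ _ _ jU)) _.
apply: cls_eq; exists (sid _); split => //.
- apply: sMap_eq => n z; case: (wedge_cover z) => -[x ->] {z}.
    by rewrite [RHS]nmap_comp_inl.
  by rewrite [RHS]nmap_comp_inr.
- move=> k; rewrite image_id.
  apply/seteqP; split => [x Fx|_ [[x Fx <-]|[x Fx <-]]] //.
  by case: (wedge_cover x) => -[y xy]; rewrite xy in Fx *; [left|right]; exists y.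
Qed.

Lemma term_flaggedK a b (t : flagged a b p) :
  neck_cls (term_flagged (flagged_term t)) = neck_cls t.
Proof. by case: t => T s ea eb F Fm jF; exact: term_flagged_neck_term. Qed.

End TermFlaggedRel.

(** A levelwise inverse of a simplicial map is automatically simplicial. *)
Lemma siso_of_cancel (X Y : sSet) (f : sMap X Y) (g : forall n, Y n -> X n) :
  (forall n, cancel (f n) (g n)) -> (forall n, cancel (g n) (f n)) -> is_siso f.
Proof.
move=> fK gK.
have g_nat m n (h : dmap m n) (y : Y n) : g m (act h y) = act h (g n y).
  by rewrite -{1}[y]gK -smap_nat fK.
by exists (SMap g_nat); split; apply: sMap_eq => n x; [exact: fK|exact: gK].
Qed.

Lemma neck_to_rigid_iso (S : sSet) (a b : S 0) : is_siso (neck_to_rigid a b).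
Proof.
pose g p : rhom a b p -> neck_hom a b p :=
  quot_lift (fun t => neck_cls (term_flagged t)).
have gE p (t : term p a b) : g p (rcls t) = neck_cls (term_flagged t).
  by apply: (quot_liftE (f := fun t => neck_cls _)); exact: term_flagged_rel.
apply: (siso_of_cancel (g := g)) => p.
  by elim/quot_ind => t; rewrite neck_to_rigidE gE term_flaggedK.
elim/rcls_ind => t; rewrite gE neck_to_rigidE.
by apply: arr_rcls; exact: flagged_term_flagged.
Qed.

Theorem theorem1p3 (S : sSet) :
  exists phi : forall a b : S 0, sMap (neck_hom a b) (@hom (rigid S) a b),
    [/\ forall a b : S 0, is_siso (phi a b),
        forall (n : nat) (s : sMap (Delta n) S) (m : nat)
            (c : Phom (ord0 : 'I_n.+1) (ord_max : 'I_n.+1) m),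
          phi _ _ m (neck_cls (flagged_simplex s c)) =
            fhom (leg (rigid_cocone S) s) ord0 ord_max m c
      & forall (a b c : S 0) (n : nat) (t : flagged b c n) (u : flagged a b n),
          phi a c n (neck_cls (flagged_comp t u)) =
            ecomp (phi b c n (neck_cls t)) (phi a b n (neck_cls u))].
Proof.
exists (@neck_to_rigid S); split.
- exact: neck_to_rigid_iso.
- move=> n s m c; rewrite neck_to_rigidE; apply: arr_rcls.
  apply: arr_gen => // k; apply/seteqP; split => [l [[l' cl]|->|->]|l cl].
  + by move=> /vtx_inj <-.
  + exact: pset_src.
  + exact: pset_tgt.
  + by constructor 1; exists l.
- move=> a b c n t u; rewrite !neck_to_rigidE /= rcompE; apply: arr_rcls.
  exact: flagged_term_comp.
Qed.
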